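(* Let $\lambda$ be a partition of $n$, let $\mathcal T$ be a standard $\lambda$-tableau, and for $k=1,\dots,n$ let $\sigma_k=q^{2(j-i)}$, where $(i,j)$ (row $i$, column $j$) is the cell of $\mathcal T$ occupied by $k$. Let $$f(\lambda)=\prod_{\alpha\in\lambda}\frac{q^{c_\alpha}}{[h_\alpha]_q},$$ let $E_{\mathcal T}\in\mathcal H_n$ be the corresponding primitive idempotent, and let $\mathrm{qdim}\,\mathcal T=\mathcal{T}r^{\,n}(E_{\mathcal T})$, where $\mathcal{T}r^{\,n}$ is the Ocneanu–Markov trace with fixed parameter $Q\in\mathbb C$. Then $$f(\lambda)=\mathrm{qdim}\,\mathcal T\;\prod_{k=1}^{n}\sigma_k\left(Q+\frac{\sigma_k-1}{q-q^{-1}}\right)^{-1}.$$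
   Context: **Hecke algebra.** $q$ is a formal variable. $\mathcal H_n$ is the unital associative algebra over $\mathbb C(q)$ with generators $T_1,\dots,T_{n-1}$ and relations $T_iT_{i+1}T_i=T_{i+1}T_iT_{i+1}$, $T_iT_j=T_jT_i$ for $|i-j|>1$, and $T_i^2=1+(q-q^{-1})T_i$. For $m\leqslant n$, $\mathcal H_m$ is regarded as the subalgebra of $\mathcal H_n$ generated by $T_1,\dots,T_{m-1}$; $\mathcal H_0=\mathcal H_1=\mathbb C(q)$. **Jucys–Murphy elements.** $y_1=1$, $y_{k+1}=T_ky_kT_k$ for $k=1,\dots,n-1$; they commute pairwise. **Combinatorics.** A partition is identified with its diagram (left-justified rows, row $i$ having $\lambda_i$ cells). A $\lambda$-tableau is a bijective filling of the cells with $1,\dots,n$; it is standard if entries increase along rows and down columns. The $q$-content of the cell in row $i$, column $j$ is $q^{2(j-i)}$. A cell outside a diagram $\mu$ is addable to $\mu$ if its union with $\mu$ is a diagram. With $\lambda'$ the conjugate partition, the cell $\alpha=(i,j)$ of $\lambda$ has hook length $h_\alpha=\lambda_i+\lambda'_j-i-j+1$ and content $c_\alpha=j-i$. Also $[m]_q=(q^m-q^{-m})/(q-q^{-1})$. **Idempotents.** The orthogonal primitive idempotents $E_{\mathcal T}\in\mathcal H_n$ are defined inductively: $E_{\mathcal T}=1$ if $n=1$; for $n\geqslant2$, $$E_{\mathcal T}=E_{\mathcal U}\,\frac{(y_n-\rho_1)\cdots(y_n-\rho_r)}{(\sigma-\rho_1)\cdots(\sigma-\rho_r)},$$ where $\mathcal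 U$ is obtained from $\mathcal T$ by removing the cell $\alpha$ occupied by $n$, $\mu$ is the shape of $\mathcal U$, $\sigma$ is the $q$-content of $\alpha$, and $\rho_1,\dots,\rho_r$ are the $q$-contents of all addable cells of $\mu$ other than $\alpha$. **Ocneanu–Markov trace.** Let $Q\in\mathbb C$ be a fixed parameter. The trace $\mathcal{T}r^{\,n}:\mathcal H_n\to\mathbb C(q)$ is the composition $\mathcal{T}r^{\,n}=\mathrm{Tr}_1\mathrm{Tr}_2\cdots\mathrm{Tr}_n$, where the linear maps $\mathrm{Tr}_{m+1}:\mathcal H_{m+1}\to\mathcal H_m$ are determined by the following properties, for $X,Y\in\mathcal H_m$ and $Z\in\mathcal H_{m+1}$ (those involving $T_m$ for $m\geqslant1$): - $\mathrm{Tr}_{m+1}(XZY)=X\,\mathrm{Tr}_{m+1}(Z)\,Y$; - $\mathrm{Tr}_{m+1}(X)=QX$ (in particular $\mathrm{Tr}_1(1)=Q$); - $\mathrm{Tr}_{m+1}(T_m^{\pm1}XT_m^{\mp1})=\mathrm{Tr}_m(X)$; - $\mathrm{Tr}_{m+1}(T_m)=1$; - $\mathrm{Tr}_m\mathrm{Tr}_{m+1}(T_mZ)=\mathrm{Tr}_m\mathrm{Tr}_{m+1}(ZT_m)$.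
   Formalization: The parameter Q is assumed to be nonzero: since σ_1 = 1, the factor for k = 1 on the right-hand side is Q^{-1}, so the formula is undefined at Q = 0. *)

(* Defs.v *)
From HB Require Import structures.
From mathcomp Require Import all_boot all_order all_algebra.
From mathcomp Require Import boolp reals.
From mathcomp Require Import complex.

Set Implicit Arguments.
Unset Strict Implicit.
Unset Printing Implicit Defensive.

Import GRing.Theory.

Local Open Scope ring_scope.
Local Open Scope quotient_scope.

(** [hecke q n] is the unital associative algebra presented by the generators
    [T_1, ..., T_(n-1)] and the Hecke relations: formal algebra expressions in
    the generators, modulo the least congruence which contains the axioms of
    unital associative algebras and the relations.  The generator [T_(i+1)] is
    indexed by [i : 'I_n.-1]. *)

Inductive hecke_expr (K : Type) (n : nat) : Type :=
| HGen of 'I_n.-1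
| HScal of K
| HAdd of hecke_expr K n & hecke_expr K n
| HMul of hecke_expr K n & hecke_expr K n.

Arguments HGen {K n}.
Arguments HScal {K n}.

HB.instance Definition _ (K : Type) n := gen_eqMixin (hecke_expr K n).
HB.instance Definition _ (K : Type) n := gen_choiceMixin (hecke_expr K n).

Inductive hecke_eq (K : fieldType) (q : K) (n : nat) :
  hecke_expr K n -> hecke_expr K n -> Prop :=
| heq_refl x : hecke_eq q x x
| heq_sym x y : hecke_eq q x y -> hecke_eq q y x
| heq_trans x y z : hecke_eq q x y -> hecke_eq q y z -> hecke_eq q x z
| heq_add x x' y y' : hecke_eq q x x' -> hecke_eq q y y' ->
    hecke_eq q (HAdd x y) (HAdd x' y')
| heq_mul x x' y y' : hecke_eq q x x' -> hecke_eq q y y' ->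
    hecke_eq q (HMul x y) (HMul x' y')
| heq_addA x y z : hecke_eq q (HAdd x (HAdd y z)) (HAdd (HAdd x y) z)
| heq_addC x y : hecke_eq q (HAdd x y) (HAdd y x)
| heq_add0 x : hecke_eq q (HAdd (HScal 0) x) x
| heq_addN x : hecke_eq q (HAdd (HMul (HScal (-1)) x) x) (HScal 0)
| heq_mulA x y z : hecke_eq q (HMul x (HMul y z)) (HMul (HMul x y) z)
| heq_mul1 x : hecke_eq q (HMul (HScal 1) x) x
| heq_mulDl x y z :
    hecke_eq q (HMul (HAdd x y) z) (HAdd (HMul x z) (HMul y z))
| heq_mulDr x y z :
    hecke_eq q (HMul x (HAdd y z)) (HAdd (HMul x y) (HMul x z))
| heq_scalD a b : hecke_eq q (HScal (a + b)) (HAdd (HScal a) (HScal b))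
| heq_scalM a b : hecke_eq q (HScal (a * b)) (HMul (HScal a) (HScal b))
| heq_scalC a x : hecke_eq q (HMul (HScal a) x) (HMul x (HScal a))
| heq_braid (i j : 'I_n.-1) : j = i.+1 :> nat ->
    hecke_eq q (HMul (HMul (HGen i) (HGen j)) (HGen i))
               (HMul (HMul (HGen j) (HGen i)) (HGen j))
| heq_far (i j : 'I_n.-1) : (i.+1 < j)%N || (j.+1 < i)%N ->
    hecke_eq q (HMul (HGen i) (HGen j)) (HMul (HGen j) (HGen i))
| heq_quad (i : 'I_n.-1) :
    hecke_eq q (HMul (HGen i) (HGen i))
               (HAdd (HScal 1) (HMul (HScal (q - q^-1)) (HGen i))).

Section HeckeQuotient.
Variables (K : fieldType) (q : K) (n : nat).

Definition hecke_eqb : rel (hecke_expr K n) := fun x y => `[< hecke_eq q x y >].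

Lemma hecke_eqb_refl : reflexive hecke_eqb.
Proof. by move=> x; apply/asboolP; exact: heq_refl. Qed.

Lemma hecke_eqb_sym : symmetric hecke_eqb.
Proof. by move=> x y; apply/asboolP/asboolP => /heq_sym. Qed.

Lemma hecke_eqb_trans : transitive hecke_eqb.
Proof.
by move=> y x z /asboolP xy /asboolP yz; apply/asboolP/(heq_trans xy yz).
Qed.

Canonical hecke_equiv :=
  EquivRel hecke_eqb hecke_eqb_refl hecke_eqb_sym hecke_eqb_trans.

Definition hecke : Type := {eq_quot hecke_eqb}.

HB.instance Definition _ := Choice.on hecke.

Definition hecke_class (x : hecke_expr K n) : hecke := \pi_{eq_quot hecke_eqb} x.
Definition hecke_repr (x : hecke) : hecke_expr K n :=
  repr (x : {eq_quot hecke_eqb}).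

Lemma hecke_reprK x : hecke_class (hecke_repr x) = x.
Proof. exact: reprK. Qed.

Lemma hecke_classP x y : hecke_eq q x y <-> hecke_class x = hecke_class y.
Proof.
split=> [xy|]; first by apply/eqmodP/asboolP.
by move/eqmodP/asboolP.
Qed.

Lemma hecke_classK x : hecke_eq q (hecke_repr (hecke_class x)) x.
Proof. by apply/hecke_classP; rewrite hecke_reprK. Qed.

Definition hecke_scalar (a : K) : hecke := hecke_class (HScal a).
Definition hecke_add (x y : hecke) : hecke :=
  hecke_class (HAdd (hecke_repr x) (hecke_repr y)).
Definition hecke_mul (x y : hecke) : hecke :=
  hecke_class (HMul (hecke_repr x) (hecke_repr y)).
Definition hecke_opp (x : hecke) : hecke := hecke_mul (hecke_scalar (-1)) x.

Lemma hecke_class_add x y :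
  hecke_add (hecke_class x) (hecke_class y) = hecke_class (HAdd x y).
Proof. by apply/hecke_classP/heq_add; exact: hecke_classK. Qed.

Lemma hecke_class_mul x y :
  hecke_mul (hecke_class x) (hecke_class y) = hecke_class (HMul x y).
Proof. by apply/hecke_classP/heq_mul; exact: hecke_classK. Qed.

Lemma hecke_addA : associative hecke_add.
Proof.
move=> x y z; rewrite -[x]hecke_reprK -[y]hecke_reprK -[z]hecke_reprK.
by rewrite !hecke_class_add; apply/hecke_classP/heq_addA.
Qed.

Lemma hecke_addC : commutative hecke_add.
Proof. by move=> x y; apply/hecke_classP/heq_addC. Qed.

Lemma hecke_add0 : left_id (hecke_scalar 0) hecke_add.
Proof.
move=> x; rewrite -[x]hecke_reprK hecke_class_add.
by apply/hecke_classP/heq_add0.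
Qed.

Lemma hecke_addN : left_inverse (hecke_scalar 0) hecke_opp hecke_add.
Proof.
move=> x; rewrite -[x]hecke_reprK /hecke_opp hecke_class_mul hecke_class_add.
by apply/hecke_classP/heq_addN.
Qed.

HB.instance Definition _ :=
  GRing.isZmodule.Build hecke hecke_addA hecke_addC hecke_add0 hecke_addN.

Lemma hecke_mulA : associative hecke_mul.
Proof.
move=> x y z; rewrite -[x]hecke_reprK -[y]hecke_reprK -[z]hecke_reprK.
by rewrite !hecke_class_mul; apply/hecke_classP/heq_mulA.
Qed.

Lemma hecke_mul1 : left_id (hecke_scalar 1) hecke_mul.
Proof.
move=> x; rewrite -[x]hecke_reprK hecke_class_mul.
by apply/hecke_classP/heq_mul1.
Qed.

Lemma hecke_scalarC a x :
  hecke_mul (hecke_scalar a) x = hecke_mul x (hecke_scalar a).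
Proof.
rewrite -[x]hecke_reprK !hecke_class_mul.
by apply/hecke_classP/heq_scalC.
Qed.

Lemma hecke_mulr1 : right_id (hecke_scalar 1) hecke_mul.
Proof. by move=> x; rewrite -hecke_scalarC hecke_mul1. Qed.

Lemma hecke_mulDl : left_distributive hecke_mul +%R.
Proof.
move=> x y z; rewrite -[x]hecke_reprK -[y]hecke_reprK -[z]hecke_reprK.
rewrite /GRing.add /= !(hecke_class_mul, hecke_class_add).
by apply/hecke_classP/heq_mulDl.
Qed.

Lemma hecke_mulDr : right_distributive hecke_mul +%R.
Proof.
move=> x y z; rewrite -[x]hecke_reprK -[y]hecke_reprK -[z]hecke_reprK.
rewrite /GRing.add /= !(hecke_class_mul, hecke_class_add).
by apply/hecke_classP/heq_mulDr.
Qed.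

HB.instance Definition _ := GRing.Zmodule_isPzRing.Build hecke
  hecke_mulA hecke_mul1 hecke_mulr1 hecke_mulDl hecke_mulDr.

Definition hecke_relations (A : algType K) (g : 'I_n.-1 -> A) : Prop :=
  [/\ forall i j : 'I_n.-1, j = i.+1 :> nat -> g i * g j * g i = g j * g i * g j,
      forall i j : 'I_n.-1, (i.+1 < j)%N || (j.+1 < i)%N -> g i * g j = g j * g i
    & forall i : 'I_n.-1, g i * g i = 1 + (q - q^-1) *: g i].

Fixpoint hecke_eval (A : algType K) (g : 'I_n.-1 -> A) (x : hecke_expr K n) : A :=
  match x with
  | HGen i => g i
  | HScal a => a%:A
  | HAdd x y => hecke_eval g x + hecke_eval g y
  | HMul x y => hecke_eval g x * hecke_eval g y
  end.

Lemma hecke_eval_eq (A : algType K) (g : 'I_n.-1 -> A) :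
  hecke_relations g ->
  forall x y, hecke_eq q x y -> hecke_eval g x = hecke_eval g y.
Proof.
move=> [braid far quad] x y; elim=> {x y} /=.
- by [].
- by [].
- by move=> x y z _ -> _ ->.
- by move=> x x' y y' _ -> _ ->.
- by move=> x x' y y' _ -> _ ->.
- by move=> x y z; rewrite addrA.
- by move=> x y; rewrite addrC.
- by move=> x; rewrite scale0r add0r.
- by move=> x; rewrite -scalerAl mul1r scaleN1r addNr scale0r.
- by move=> x y z; rewrite mulrA.
- by move=> x; rewrite scale1r mul1r.
- by move=> x y z; rewrite mulrDl.
- by move=> x y z; rewrite mulrDr.
- by move=> a b; rewrite scalerDl.
- by move=> a b; rewrite -scalerAl mul1r scalerA.
- by move=> a x; rewrite -scalerAl -scalerAr mul1r mulr1.
- exact: braid.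
- exact: far.
- by move=> i; rewrite quad scale1r -scalerAl mul1r.
Qed.

Lemma hecke_nontrivial : (1 : hecke) != 0.
Proof.
apply/eqP => /hecke_classP eq10.
pose c : K := if q == 0 then 1 else q.
have rel_c : hecke_relations (fun _ : 'I_n.-1 => c : K^o).
  split=> // _; rewrite /c; case: eqVneq => [->|q0].
    by rewrite invr0 subr0 scale0r addr0 mulr1.
  by rewrite /GRing.scale /= mulrBl mulVf // addrC subrK.
have /eqP := hecke_eval_eq rel_c eq10.
by rewrite /= scale1r scale0r oner_eq0.
Qed.

HB.instance Definition _ :=
  GRing.PzSemiRing_isNonZero.Build hecke hecke_nontrivial.

Definition hecke_scale (a : K) (x : hecke) : hecke := hecke_mul (hecke_scalar a) x.

Lemma hecke_scaleA a b x :
  hecke_scale a (hecke_scale b x) = hecke_scale (a * b) x.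
Proof.
rewrite /hecke_scale hecke_mulA; congr hecke_mul.
by rewrite hecke_class_mul; apply/hecke_classP/heq_sym/heq_scalM.
Qed.

Lemma hecke_scale1 : left_id 1 hecke_scale.
Proof. exact: hecke_mul1. Qed.

Lemma hecke_scaleDr : right_distributive hecke_scale +%R.
Proof. by move=> a x y; exact: hecke_mulDr. Qed.

Lemma hecke_scaleDl x : {morph hecke_scale^~ x : a b / a + b}.
Proof.
move=> a b; rewrite /hecke_scale -hecke_mulDl; congr hecke_mul.
by rewrite /GRing.add /= hecke_class_add; apply/hecke_classP/heq_scalD.
Qed.

HB.instance Definition _ := GRing.Zmodule_isLmodule.Build K hecke
  hecke_scaleA hecke_scale1 hecke_scaleDr hecke_scaleDl.

Lemma hecke_scaleAl (a : K) (x y : hecke) : a *: (x * y) = (a *: x) * y.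
Proof. exact: hecke_mulA. Qed.

HB.instance Definition _ :=
  GRing.Lmodule_isLalgebra.Build K hecke hecke_scaleAl.

Lemma hecke_scaleAr (a : K) (x y : hecke) : a *: (x * y) = x * (a *: y).
Proof.
change (hecke_mul (hecke_scalar a) (hecke_mul x y)
        = hecke_mul x (hecke_mul (hecke_scalar a) y)).
by rewrite !hecke_mulA hecke_scalarC.
Qed.

HB.instance Definition _ :=
  GRing.Lalgebra_isAlgebra.Build K hecke hecke_scaleAr.

Definition hecke_gen (i : 'I_n.-1) : hecke := hecke_class (HGen i).

Lemma hecke_genP : hecke_relations hecke_gen.
Proof.
split=> [i j ij|i j ij|i].
- change (hecke_mul (hecke_mul (hecke_gen i) (hecke_gen j)) (hecke_gen i)
          = hecke_mul (hecke_mul (hecke_gen j) (hecke_gen i)) (hecke_gen j)).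
  rewrite /hecke_gen !hecke_class_mul; apply/hecke_classP.
  exact: heq_braid.
- change (hecke_mul (hecke_gen i) (hecke_gen j)
          = hecke_mul (hecke_gen j) (hecke_gen i)).
  rewrite /hecke_gen !hecke_class_mul; apply/hecke_classP.
  exact: heq_far.
- change (hecke_mul (hecke_gen i) (hecke_gen i)
          = hecke_add (hecke_scalar 1)
              (hecke_mul (hecke_scalar (q - q^-1)) (hecke_gen i))).
  rewrite /hecke_gen /hecke_scalar !(hecke_class_mul, hecke_class_add); apply/hecke_classP.
  exact: heq_quad.
Qed.

Definition hecke_hom (A : algType K) (g : 'I_n.-1 -> A)
  (gP : hecke_relations g) (x : hecke) : A := hecke_eval g (hecke_repr x).

Section Hom.
Variables (A : algType K) (g : 'I_n.-1 -> A) (gP : hecke_relations g).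

Lemma hecke_hom_class x : hecke_hom gP (hecke_class x) = hecke_eval g x.
Proof. exact: hecke_eval_eq (hecke_classK x). Qed.

Lemma hecke_hom_linear : linear (hecke_hom gP).
Proof.
move=> a x y; rewrite -[x]hecke_reprK -[y]hecke_reprK.
rewrite [a *: _]hecke_class_mul [_ + _]hecke_class_add !hecke_hom_class /=.
by rewrite -scalerAl mul1r.
Qed.

Lemma hecke_hom_monoid : monoid_morphism (hecke_hom gP).
Proof.
split=> [|x y]; first by rewrite [LHS]hecke_hom_class /= scale1r.
rewrite -[x]hecke_reprK -[y]hecke_reprK.
by rewrite [_ * _]hecke_class_mul !hecke_hom_class.
Qed.

HB.instance Definition _ :=
  GRing.isLinear.Build K hecke A *:%R (hecke_hom gP) hecke_hom_linear.
HB.instance Definition _ :=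
  GRing.isMonoidMorphism.Build hecke A (hecke_hom gP) hecke_hom_monoid.

Lemma hecke_hom_gen i : hecke_hom gP (hecke_gen i) = g i.
Proof. exact: hecke_hom_class. Qed.

Lemma hecke_hom_unique (phi : {lrmorphism hecke -> A}) :
  (forall i, phi (hecke_gen i) = g i) -> phi =1 hecke_hom gP.
Proof.
move=> phig x; rewrite -[x]hecke_reprK hecke_hom_class.
elim: (hecke_repr x) => {x} [i|a|x IHx y IHy|x IHx y IHy] /=.
- exact: phig.
- have -> : hecke_class (HScal a) = a%:A by exact: esym (hecke_mulr1 _).
  by rewrite linearZ rmorph1.
- by rewrite -IHx -IHy -rmorphD /GRing.add /= hecke_class_add.
- by rewrite -IHx -IHy -rmorphM /GRing.mul /= hecke_class_mul.
Qed.

End Hom.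

End HeckeQuotient.

Section HeckeTower.
Variables (K : fieldType) (q : K).

(** The inclusion [H_m -> H_(m+1)], [T_i |-> T_i]. *)

Definition hecke_incl_gen m (i : 'I_m.-1) : hecke q m.+1 :=
  hecke_gen q (widen_ord (leq_pred m) i : 'I_m.+1.-1).

Lemma hecke_incl_subproof m : hecke_relations q (@hecke_incl_gen m).
Proof.
have [braid far quad] := hecke_genP q m.+1.
split=> [i j ij|i j ij|i]; first exact: braid; first exact: far.
exact: quad.
Qed.

Definition hecke_incl m : hecke q m -> hecke q m.+1 :=
  hecke_hom (@hecke_incl_subproof m).

HB.instance Definition _ m := GRing.LRMorphism.on (@hecke_incl m).

(** [H_0] is the field [K], as it has no generator. *)

Definition hecke0_gen (i : 'I_0) : K^o := 0.

Lemma hecke0_subproof : @hecke_relations K q 0 K^o hecke0_gen.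
Proof. by split=> [[]|[]|[]]. Qed.

Definition hecke0_val : hecke q 0 -> K := hecke_hom hecke0_subproof.

Lemma hecke0_valK x : (hecke0_val x)%:A = x.
Proof.
have mulE (a b : K) : (a * b)%:A = a%:A * b%:A :> hecke q 0.
  by rewrite -scalerAl mul1r scalerA.
rewrite -[x]hecke_reprK /hecke0_val hecke_hom_class.
elim: (hecke_repr x) => {x} [[]|a|x IHx y IHy|x IHx y IHy] //=.
- by rewrite /GRing.scale /= mulr1; exact: hecke_mulr1.
- by rewrite scalerDl IHx IHy [LHS]hecke_class_add.
- by rewrite mulE IHx IHy [LHS]hecke_class_mul.
Qed.

(** [T_(m+1)], the last generator of [H_(m+2)], and its inverse. *)

Definition hecke_T m : hecke q m.+2 := hecke_gen q (ord_max : 'I_m.+2.-1).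

Definition hecke_Tinv m : hecke q m.+2 := hecke_T m - (q - q^-1)%:A.

Lemma hecke_TV m : hecke_T m * hecke_Tinv m = 1.
Proof.
have [_ _ quad] := hecke_genP q m.+2.
by rewrite /hecke_Tinv mulrBr quad -scalerAr mulr1 addrK.
Qed.

Lemma hecke_VT m : hecke_Tinv m * hecke_T m = 1.
Proof.
have [_ _ quad] := hecke_genP q m.+2.
by rewrite /hecke_Tinv mulrBl quad -scalerAl mul1r addrK.
Qed.

(** Jucys-Murphy elements: [jucys_murphy m] is [y_(m+1)], as an element of
    [H_(m+1)]. *)

Fixpoint jucys_murphy (m : nat) : hecke q m.+1 :=
  match m with
  | 0 => 1
  | p.+1 => hecke_T p * hecke_incl (jucys_murphy p) * hecke_T p
  end.

(** [Tr m] is the map [Tr_(m+1) : H_(m+1) -> H_m]. *)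

Record ocneanu_markov (Q : K) (Tr : forall m, {linear hecke q m.+1 -> hecke q m})
  : Prop := OcneanuMarkov {
  om_bimodule : forall m (X Y : hecke q m) (Z : hecke q m.+1),
    Tr m (hecke_incl X * Z * hecke_incl Y) = X * Tr m Z * Y;
  om_incl : forall m (X : hecke q m), Tr m (hecke_incl X) = Q *: X;
  om_conjT : forall m (X : hecke q m.+1),
    Tr m.+1 (hecke_T m * hecke_incl X * hecke_Tinv m) = hecke_incl (Tr m X);
  om_conjV : forall m (X : hecke q m.+1),
    Tr m.+1 (hecke_Tinv m * hecke_incl X * hecke_T m) = hecke_incl (Tr m X);
  om_T : forall m, Tr m.+1 (hecke_T m) = 1;
  om_markov : forall m (Z : hecke q m.+2),
    Tr m (Tr m.+1 (hecke_T m * Z)) = Tr m (Tr m.+1 (Z * hecke_T m)) }.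

Fixpoint markov_trace (Tr : forall m, {linear hecke q m.+1 -> hecke q m})
  (n : nat) : hecke q n -> K :=
  match n with
  | 0 => hecke0_val
  | m.+1 => fun x => markov_trace Tr (Tr m x)
  end.

End HeckeTower.

(** Rows and columns are numbered from 0, so that the cell in row [i] and
    column [j] of the usual numbering is [(i.-1, j.-1)]. *)

Definition is_partition (la : seq nat) : bool := sorted geq la && (0%N \notin la).

Definition diagram (la : seq nat) : seq (nat * nat) :=
  [seq (i, j) | i <- iota 0 (size la), j <- iota 0 (nth 0%N la i)].

Definition conj_part (la : seq nat) : seq nat :=
  [seq count (ltn j) la | j <- iota 0 (head 0%N la)].

Definition content (c : nat * nat) : int := c.2%:Z - c.1%:Z.

(** [la_i + la'_j - i - j + 1] with rows and columns numbered from 1 *)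
Definition hook_length (la : seq nat) (c : nat * nat) : int :=
  (nth 0%N la c.1)%:Z + (nth 0%N (conj_part la) c.2)%:Z
    - c.1.+1%:Z - c.2.+1%:Z + 1.

(** See [addable_cellsP]: [incr_nth mu i] adds a cell at the end of row [i],
    possibly a new row. *)
Definition addable_cells (mu : seq nat) : seq (nat * nat) :=
  [seq (i, nth 0%N mu i) | i <- iota 0 (size mu).+1 & is_partition (incr_nth mu i)].

Lemma mem_diagram la c : (c \in diagram la) = (c.2 < nth 0%N la c.1)%N.
Proof.
case: c => i j /=; apply/allpairsPdep/idP => [[a [b []]]|ltj].
  by rewrite !mem_iota /= => _ ltb [-> ->].
exists i, j; split=> //; rewrite mem_iota //= add0n.
by case: ltnP => // gei; rewrite nth_default in ltj.
Qed.

Lemma is_partition_size la a : is_partition la ->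
  (0 < nth 0%N la a)%N = (a < size la)%N.
Proof.
case/andP=> _ la0; case: (ltnP a) => [lta|gea]; last by rewrite nth_default.
by rewrite lt0n; apply: contra la0 => /eqP <-; exact: mem_nth.
Qed.

Lemma addable_cellsP mu c : is_partition mu ->
  c \in addable_cells mu <->
  c \notin diagram mu /\
    exists nu, is_partition nu /\ diagram nu =i c :: diagram mu.
Proof.
move=> muP; split.
  case/mapP=> i; rewrite mem_filter => /andP[nuP _] ->; split.
    by rewrite mem_diagram /= ltnn.
  exists (incr_nth mu i); split=> // -[a b].
  rewrite inE !mem_diagram /= nth_incr_nth xpair_eqE.
  by case: eqVneq => [->|] /=; rewrite ?add1n ?ltnS ?add0n // leq_eqVlt.
case: c => i j []; rewrite mem_diagram /= -leqNgt => lej [nu [nuP nuE]].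
have nuE' a b : (b < nth 0 nu a)%N = ((a, b) == (i, j)) || (b < nth 0 mu a)%N.
  by have := nuE (a, b); rewrite inE !mem_diagram.
have ej : j = nth 0%N mu i.
  apply/eqP; rewrite eqn_leq lej andbT leqNgt; apply/negP => ltj.
  have ltn : (nth 0 mu i < nth 0 nu i)%N.
    by apply: ltn_trans ltj _; rewrite nuE' eqxx.
  by move: ltn; rewrite nuE' ltnn orbF xpair_eqE eqxx /= ltn_eqF.
have nthE a : nth 0%N nu a = ((i == a) + nth 0%N mu a)%N.
  have ltE b : (b < nth 0 nu a)%N = (b < (i == a) + nth 0 mu a)%N.
    rewrite nuE' xpair_eqE [a == i]eq_sym ej.
    by case: (eqVneq i a) => [<-|_] /=; rewrite ?add1n ?ltnS // [in RHS]leq_eqVlt.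
  apply/eqP; rewrite eqn_leq; apply/andP; split; rewrite leqNgt.
    by rewrite ltE ltnn.
  by rewrite -ltE ltnn.
have lei : (i <= size mu)%N.
  rewrite leqNgt; apply/negP => lti.
  have : (size mu < size nu)%N.
    apply: (ltn_trans lti); rewrite -(is_partition_size i nuP) nthE eqxx.
    by rewrite add1n.
  by rewrite -(is_partition_size _ nuP) nthE nth_default // gtn_eqF.
have szE a : (a < size nu)%N = (a < size (incr_nth mu i))%N.
  rewrite -(is_partition_size _ nuP) nthE addn_gt0 is_partition_size //.
  rewrite size_incr_nth lt0b; case: (ltnP i (size mu)) lei => [lti _|gei lei].
    by case: eqVneq => // <-; rewrite lti.
  have -> : size mu = i by apply/eqP; rewrite eqn_leq gei lei.
  by rewrite ltnS [in RHS]leq_eqVlt eq_sym.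
have nuI : nu = incr_nth mu i.
  apply: (@eq_from_nth _ 0%N) => [|a _]; last by rewrite nthE nth_incr_nth.
  apply/eqP; rewrite eqn_leq; apply/andP; split; rewrite leqNgt.
    by rewrite szE ltnn.
  by rewrite -szE ltnn.
by apply/mapP; exists i; [rewrite mem_filter -nuI nuP mem_iota | rewrite ej].
Qed.

(** A tableau is the sequence of its rows. *)

Definition tableau_entry (t : seq (seq nat)) (i j : nat) : nat :=
  nth 0%N (nth [::] t i) j.

Definition is_tableau (la : seq nat) (t : seq (seq nat)) : Prop :=
  shape t = la /\ perm_eq (flatten t) (iota 1 (sumn la)).

Definition is_standard (t : seq (seq nat)) : Prop :=
  (forall i j j', (i, j') \in diagram (shape t) -> (j < j')%N ->
     (tableau_entry t i j < tableau_entry t i j')%N) /\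
  (forall i i' j, (i', j) \in diagram (shape t) -> (i < i')%N ->
     (tableau_entry t i j < tableau_entry t i' j)%N).

Definition cell_of (t : seq (seq nat)) (k : nat) : nat * nat :=
  let i := find (fun r => k \in r) t in (i, index k (nth [::] t i)).

Definition remove_entry (k : nat) (t : seq (seq nat)) : seq (seq nat) :=
  [seq r <- [seq rem k r | r <- t] | r != [::]].

Section QuantumDimension.
Variables (K : fieldType) (q : K).

Definition qcontent (c : nat * nat) : K := q ^ (2 * content c).

Definition qint (m : int) : K := (q ^ m - q ^ (- m)) / (q - q^-1).

Definition qhook_product (la : seq nat) : K :=
  \prod_(c <- diagram la) (q ^ content c / qint (hook_length la c)).

(** For [n = 1] the products are empty, so that [E_T = 1]. *)
Fixpoint idempotent (n : nat) (t : seq (seq nat)) : hecke q n :=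
  match n with
  | 0 => 1
  | m.+1 =>
    let u := remove_entry m.+1 t in
    let alpha := cell_of t m.+1 in
    let others := [seq c <- addable_cells (shape u) | c != alpha] in
    (\prod_(c <- others) (qcontent alpha - qcontent c))^-1 *:
      (hecke_incl (idempotent m u)
       * \prod_(c <- others) (jucys_murphy q m - (qcontent c)%:A))
  end.

Lemma idempotent1 : idempotent 1 [:: [:: 1%N]] = 1.
Proof. by rewrite /= !big_nil invr1 scale1r rmorph1 mulr1. Qed.

Definition qdim (Tr : forall m, {linear hecke q m.+1 -> hecke q m})
  (n : nat) (t : seq (seq nat)) : K := markov_trace Tr (idempotent n t).

End QuantumDimension.

Definition Cq (R : realType) : fieldType := {fraction {poly R[i]}}.

Definition qvar (R : realType) : Cq R := tofrac 'X.

Definition Cq_const (R : realType) (a : R[i]) : Cq R := tofrac a%:P.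

(* Main.v *)
Require Import Defs.
From HB Require Import structures.
From mathcomp Require Import all_boot all_order all_algebra.
From mathcomp Require Import boolp reals.
From mathcomp Require Import complex.
From mathcomp Require Import ring zify.

(** Put [w = q - q^-1].  The idempotent is [E_T = E_U L(y_n)], so the bimodule
    property gives [Tr_n (E_T p(y_n)) = E_U Tr_n (L(y_n) p(y_n))], and the moments
    [Tr_(m+1) (y_(m+1)^k)] are polynomials in [y_1, ..., y_m].  By induction on
    the tableau, [Tr^n (E_T h(y_1, ..., y_n)) = h(sigma_1, ..., sigma_n) Tr^n (E_T)]
    for every polynomial [h]: the eigenvalue equation [y_n E_T = sigma_n E_T] is
    not needed.  Conjugation by [T_m] gives a recursion for the moments, which,
    evaluated at the contents of a diagram [mu], gives
      [sum_k x^k Tr_(m+1) (y_(m+1)^k) = (1 - x + Q w x) / w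
         * prod_(removable s) (1 - x s) / prod_(addable s) (1 - x s) + Q - 1 / w].
    The coefficient of [1 / (1 - x sigma)] is [(Q + (sigma - 1) / w) / sigma]
    times a product which equals [f (mu + cell) / f (mu)]. *)

Set Implicit Arguments.
Unset Strict Implicit.
Unset Printing Implicit Defensive.

Import GRing.Theory.

Local Open Scope ring_scope.

(** * Standard tableaux *)

Lemma part_nth_leq la i j : is_partition la -> (i <= j)%N ->
  (nth 0 la j <= nth 0 la i)%N.
Proof.
case/andP=> la_sorted _ ij; have [lt_j|ge_j] := ltnP j (size la); last first.
  by rewrite (nth_default _ ge_j).
have geq_trans : transitive geq by move=> y x z xy yz; apply: leq_trans yz xy.
have := sorted_leq_nth geq_trans leqnn 0%N la_sorted; apply=> //.
exact: leq_ltn_trans ij lt_j.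
Qed.

Lemma is_partition_nth la : (forall i, nth 0 la i.+1 <= nth 0 la i)%N ->
  (forall i, i < size la -> 0 < nth 0 la i)%N -> is_partition la.
Proof.
move=> la_le la_gt; apply/andP; split; first by apply/(sortedP 0%N) => i _; exact: la_le.
by apply/negP => /(nthP 0%N)[i /la_gt]; rewrite lt0n => /eqP + i0; rewrite i0.
Qed.

Lemma nth_shape (t : seq (seq nat)) i : nth 0%N (shape t) i = size (nth [::] t i).
Proof.
have [it|ti] := ltnP i (size t); first by rewrite (nth_map [::]).
by rewrite !nth_default ?size_map.
Qed.

Lemma mem_tableau_entry (t : seq (seq nat)) i j :
  (j < size (nth [::] t i))%N -> tableau_entry t i j \in flatten t.
Proof.
move=> jt; apply/flattenP; exists (nth [::] t i); last exact: mem_nth.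
by apply: mem_nth; rewrite ltnNge; apply: contraL jt => ti; rewrite nth_default.
Qed.

Lemma is_partition_incr mu r : is_partition mu -> (r <= size mu)%N ->
  (forall r', r = r'.+1 -> nth 0 mu r < nth 0 mu r')%N -> is_partition (incr_nth mu r).
Proof.
move=> muP rs rP; apply: is_partition_nth => i.
  rewrite !nth_incr_nth; case: eqVneq => [ri|_]; last by rewrite add0n (leq_trans (part_nth_leq muP (leqnSn i))) // leq_addl.
  have := rP i ri; rewrite ri gtn_eqF //.
rewrite nth_incr_nth size_incr_nth; case: (ltnP r (size mu)) => [rm|mr] im.
  by rewrite addn_gt0 is_partition_size // im orbT.
rewrite addn_gt0 is_partition_size // lt0b.
by move: im; rewrite ltnS leq_eqVlt eq_sym => /orP[->//|ir]; rewrite (leq_trans ir rs) orbT.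
Qed.

Lemma perm_flatten_rcons (t1 t2 : seq (seq nat)) p x :
  perm_eq (flatten (t1 ++ rcons p x :: t2)) (x :: flatten (t1 ++ p :: t2)).
Proof.
by rewrite !flatten_cat /= cat_rcons catA -[_ :: flatten t2]cat1s perm_catCA /= -catA.
Qed.

(** An entry to the right of [n.+1] or below it would exceed the maximum. Hence [n.+1] ends its row,
    and the next row fits under what remains of it. *)
Lemma standard_corner n la t : is_partition la -> sumn la = n.+1 ->
  is_tableau la t -> is_standard t ->
  exists t1 p t2, [/\ t = t1 ++ rcons p n.+1 :: t2, n.+1 \notin flatten (t1 ++ p :: t2)
    & (size (nth [::] t2 0) <= size p)%N].
Proof.
move=> laP lan [tla tP] [t_row t_col]; rewrite lan in tP.
have t_uniq : uniq (flatten t) by rewrite (perm_uniq tP) iota_uniq.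
have t_max k : k \in flatten t -> (k <= n.+1)%N.
  by rewrite (perm_mem tP) mem_iota => /andP[_]; rewrite add1n ltnS.
have : n.+1 \in flatten t by rewrite (perm_mem tP) mem_iota /=; lia.
case/flattenP => r rt nr.
have [t1 [t2 tE]] : exists t1 t2, t = t1 ++ r :: t2.
  by case/splitPr: rt => t1 t2; exists t1, t2.
have rE : nth [::] t (size t1) = r by rewrite tE nth_cat ltnn subnn.
have [p rp] : exists p, r = rcons p n.+1.
  exists (take (index n.+1 r) r).
  have ir : (index n.+1 r < size r)%N by rewrite index_mem.
  rewrite -[in X in rcons _ X](nth_index 0%N nr) -take_nth // -[LHS]take_size.
  congr take; apply/eqP; rewrite eqn_leq ir andbT leqNgt; apply/negP => lt_ir.
  have := t_row (size t1) (index n.+1 r) (index n.+1 r).+1.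
  rewrite mem_diagram /= nth_shape rE => /(_ lt_ir (ltnSn _)).
  rewrite {1}/tableau_entry rE nth_index // ltnNge t_max //.
  by apply: mem_tableau_entry; rewrite rE.
exists t1, p, t2; split; first by rewrite tE rp.
  have : perm_eq (flatten t) (n.+1 :: flatten (t1 ++ p :: t2)).
    by rewrite tE rp perm_flatten_rcons.
  by move/perm_uniq; rewrite t_uniq => /esym/andP[].
rewrite leqNgt; apply/negP => lt_p.
have t2E : nth [::] t (size t1).+1 = nth [::] t2 0.
  by rewrite tE nth_cat ltnNge leqnSn /= subSn // subnn.
have := t_col (size t1) (size t1).+1 (size p).
rewrite mem_diagram /= nth_shape t2E => /(_ lt_p (ltnSn _)).
rewrite {1}/tableau_entry rE rp nth_rcons ltnn eqxx ltnNge t_max //.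
by apply: mem_tableau_entry; rewrite t2E.
Qed.

Lemma incr_nth_cat s1 a s2 : incr_nth (s1 ++ a :: s2) (size s1) = s1 ++ a.+1 :: s2.
Proof. by elim: s1 => //= b s1 ->. Qed.

Lemma incr_nth_size s : incr_nth s (size s) = rcons s 1%N.
Proof. by elim: s => //= a s ->. Qed.

Lemma standard_remove n la t (u := remove_entry n.+1 t) (mu := shape u)
    (c := cell_of t n.+1) :
  is_partition la -> sumn la = n.+1 -> is_tableau la t -> is_standard t ->
  [/\ is_partition mu, sumn mu = n, is_tableau mu u, is_standard u
    & [/\ la = incr_nth mu c.1, c.2 = nth 0%N mu c.1, (c.1 <= size mu)%N
      & forall k, (0 < k <= n)%N -> cell_of u k = cell_of t k]].
Proof.
move=> laP lan tT tS.
have [t1 [p [t2 [tE xv t2p]]]] := standard_corner laP lan tT tS.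
have [tla tP] := tT; rewrite lan in tP; have [t_row t_col] := tS.
pose x := n.+1; rewrite -/x in tE xv; pose v := t1 ++ p :: t2.
have [x1 xp x2] : [/\ x \notin flatten t1, x \notin p & x \notin flatten t2].
  by move: xv; rewrite flatten_cat /= !mem_cat !negb_or => /and3P[].
have rem_rows s : x \notin flatten s -> [seq rem x r | r <- s] = s.
  elim: s => //= r s IHs; rewrite mem_cat negb_or => /andP[xr /IHs ->].
  by rewrite rem_id.
have row_ne r : r \in t -> r != [::].
  move=> rt; case/andP: laP => _; apply: contra => /eqP r0.
  by rewrite -tla; apply/mapP; exists r; rewrite // r0.
have uE : u = [seq r <- v | r != [::]].
  rewrite /u /remove_entry -/x tE map_cat /= !rem_rows // /v; congr filter; congr (_ ++ _ :: _).
  elim: (p) xp => [|a s IHs] /=; first by rewrite eqxx.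
  by rewrite inE negb_or => /andP[xa /IHs ->]; rewrite eq_sym (negPf xa).
have t1_ne : [seq r <- t1 | r != [::]] = t1.
  by apply/all_filterP/allP => r rt; apply: row_ne; rewrite tE mem_cat rt.
have t2_ne : [seq r <- t2 | r != [::]] = t2.
  by apply/all_filterP/allP => r rt; apply: row_ne; rewrite tE mem_cat inE rt !orbT.
(* [u] and [v] differ only if [n.+1] is alone in its row, which is then the last one. Rows out of
   range are read as [[::]], so [nth] and [flatten] do not see the difference. *)
have uv : u = v \/ [/\ u = t1, p = [::] & t2 = [::]].
  rewrite uE /v filter_cat /= t1_ne t2_ne; case: eqVneq => [p0|]; [right|by left].
  have t20 : t2 = [::].
    move: t2p t2_ne; rewrite p0; case: (t2) => //= r s; rewrite leqn0 size_eq0 => /eqP -> /=.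
    move=> sE; have : [::] \in [seq r <- s | r != [::]] by rewrite sE mem_head.
    by rewrite mem_filter eqxx.
  by rewrite t20 cats0.
have nth_u i : nth [::] u i = nth [::] v i.
  case: uv => [-> //|[-> p0 t20]]; rewrite /v p0 t20 cats1 nth_rcons.
  by case: ltngtP => // [ti|->]; rewrite nth_default // ltnW.
have flat_u : flatten u = flatten v.
  by case: uv => [-> //|[-> p0 t20]]; rewrite /v p0 t20 flatten_cat cats0.
have nth_v i : nth [::] v i = if i == size t1 then p else nth [::] t i.
  rewrite /v tE !nth_cat; case: ltngtP => // [ti|->]; last by rewrite subnn.
  by case: (i - size t1)%N (subn_gt0 (size t1) i) => //=; rewrite ti.
have t_r0 : nth [::] t (size t1) = rcons p x by rewrite tE nth_cat ltnn subnn.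
have cE : c = (size t1, size p).
  have c1 : find (fun r => x \in r) t = size t1.
    rewrite tE find_cat /= mem_rcons inE eqxx addn0 ifN //.
    by apply: contra x1 => /hasP[r rt xr]; apply/flattenP; exists r.
  rewrite /c /cell_of -/x c1 t_r0; congr (_, _).
  by rewrite -cats1 index_cat (negPf xp) /= eqxx addn0.
have mu_nth i : nth 0%N mu i = if i == size t1 then size p else nth 0%N la i.
  by rewrite -tla !nth_shape nth_u nth_v; case: eqP.
have muP : is_partition mu.
  apply: is_partition_nth => i; rewrite ?mu_nth; last first.
    rewrite -mu_nth nth_shape size_map => iu; rewrite lt0n size_eq0.
    by have := mem_nth [::] iu; rewrite {2}uE mem_filter => /andP[].
  have la_r0 : nth 0%N la (size t1) = (size p).+1 by rewrite -tla nth_shape t_r0 size_rcons.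
  case: (eqVneq i (size t1)) => [->|it].
    rewrite gtn_eqF // -tla nth_shape tE nth_cat ltnNge leqnSn /= subSn // subnn.
    exact: t2p.
  case: eqVneq => [i1|_]; last exact: part_nth_leq.
  by apply: leq_trans (part_nth_leq laP (leqnSn i)); rewrite i1 la_r0.
have u_perm : perm_eq (flatten u) (iota 1 n).
  rewrite flat_u -(perm_cons x) perm_sym -/v.
  have := perm_flatten_rcons t1 t2 p x; rewrite -tE => /permPl tv.
  rewrite perm_sym -tv; apply: perm_trans tP _.
  by rewrite -(addn1 n) iotaD add1n perm_catC.
have mun : sumn mu = n by rewrite -size_flatten (perm_size u_perm) size_iota.
have entry_u i j : (j < nth 0 mu i)%N -> tableau_entry u i j = tableau_entry t i j.
  rewrite mu_nth /tableau_entry nth_u nth_v; case: eqVneq => [->|//] jp.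
  by rewrite t_r0 nth_rcons jp.
have mu_la i j : (j < nth 0 mu i)%N -> (j < nth 0 la i)%N.
  rewrite mu_nth; case: eqVneq => [->|//] jp.
  by rewrite -tla nth_shape t_r0 size_rcons (leq_trans jp).
split=> //.
- by split=> //; rewrite mun.
- split=> [i j j'|i i' j]; rewrite mem_diagram /= => jmu lt_j.
    rewrite !entry_u //; last exact: ltn_trans lt_j jmu.
    by apply: t_row => //; rewrite mem_diagram tla mu_la.
  rewrite !entry_u //; last exact: leq_trans jmu (part_nth_leq muP (ltnW lt_j)).
  by apply: t_col => //; rewrite mem_diagram tla mu_la.
rewrite cE /=; split.
- rewrite -tla /mu; case: uv => [->|[-> p0 t20]].
    by rewrite /v tE /shape !map_cat /= size_rcons -(size_map size t1) incr_nth_cat.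
  by rewrite -(size_map size t1) incr_nth_size tE p0 t20 /shape map_cat cats1.
- by rewrite mu_nth eqxx.
- case: uv => [mE|[mE _ _]]; rewrite /mu mE size_map // /v size_cat; exact: leq_addr.
- move=> k /andP[k0 kn].
  have kx : k != x by rewrite neq_ltn ltnS kn.
  have ku : has (fun r => k \in r) u.
    have : k \in flatten u by rewrite (perm_mem u_perm) mem_iota k0 add1n ltnS.
    by case/flattenP => r ru kr; apply/hasP; exists r.
  have fuv : find (fun r => k \in r) u = find (fun r => k \in r) v.
    case: uv => [-> //|[ut1 p0 t20]]; by rewrite /v p0 t20 -ut1 find_cat ku.
  have fvt : find (fun r => k \in r) v = find (fun r => k \in r) t.
    rewrite /v tE !find_cat /=; case: has => //.
    by rewrite mem_rcons inE (negPf kx).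
  rewrite /cell_of fuv fvt; congr (_, _); rewrite nth_u nth_v.
  case: eqVneq => [fE|//]; rewrite fE t_r0 -cats1 index_cat.
  have : k \in nth [::] u (find (fun r => k \in r) u) by apply: (nth_find [::] ku).
  by rewrite nth_u nth_v fuv fvt fE eqxx => ->.
Qed.

(** * Residues of the moment generating function *)

Section BigOption.
Variables (R : Type) (idx : R) (op : Monoid.com_law idx) (I : finType).
Variable F : option I -> R.

Lemma big_neq_None : \big[op/idx]_(o | o != None) F o = \big[op/idx]_i F (Some i).
Proof.
rewrite (reindex_omap Some id) => [|[i|]] //=.
by apply: eq_bigl => i; rewrite eqxx.
Qed.

Lemma big_neq_Some r :
  \big[op/idx]_(o | o != Some r) F o = op (F None) (\big[op/idx]_(i | i != r) F (Some i)).
Proof.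
rewrite (bigD1 None) //=; congr (op _ _).
rewrite (reindex_omap Some id) => [|[i|]] //=.
by apply: eq_bigl => i; rewrite eqxx !andbT.
Qed.

End BigOption.

Section Interpolation.
Variables (K : fieldType) (I : finType) (x : I -> K).
Hypothesis x_inj : injective x.

Lemma size_prod_but1 i : size (\prod_(j | j != i) ('X - (x j)%:P)) = #|I|.
Proof.
rewrite (eq_bigl (mem (predC1 i))) // -big_enum size_prod_XsubC -cardE cardC1.
by rewrite prednK //; apply/card_gt0P; exists i.
Qed.

Lemma prod_but1_neq0 i : \prod_(j | j != i) (x i - x j) != 0.
Proof.
apply/prodf_neq0 => j ji; rewrite subr_eq0; apply: contraNneq ji => /x_inj ->.
exact: eqxx.
Qed.

(** Compare the coefficients of degree [#|I|.-1] in Lagrange's interpolation formula; the basis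
    polynomials [B i] are monic of that degree. *)
Lemma sum_interpolation (P : {poly K}) : (size P <= #|I|)%N ->
  \sum_i P.[x i] / \prod_(j | j != i) (x i - x j) = P`_(#|I|.-1).
Proof.
move=> sP; pose B i := \prod_(j | j != i) ('X - (x j)%:P).
pose c i := P.[x i] / \prod_(j | j != i) (x i - x j).
have Bx i j : (B i).[x j] = (i == j)%:R * \prod_(k | k != i) (x i - x k).
  rewrite /B horner_prod; case: eqVneq => [<-|ij].
    by rewrite mul1r; apply: eq_bigr => k _; rewrite hornerXsubC.
  by rewrite mul0r (bigD1 j) 1?eq_sym //= hornerXsubC subrr mul0r.
have PE : P = \sum_i c i *: B i.
  (* The difference has size at most [#|I|] and vanishes at [#|I|] distinct points. *)
  apply/eqP; rewrite -subr_eq0; apply: contraT => D0.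
  have /(_ [seq x i | i <- enum I]) := max_poly_roots D0.
  rewrite map_inj_uniq ?enum_uniq // size_map -cardE => /(_ _ isT).
  move=> lt_size; suff: (#|I| < #|I|)%N by rewrite ltnn.
  apply: leq_trans (lt_size _) _.
    apply/allP => _ /mapP[i _ ->]; rewrite rootE hornerD hornerN horner_sum subr_eq0.
    rewrite (bigD1 i) //= big1 => [|j ji]; rewrite hornerZ Bx.
      by rewrite eqxx mul1r addr0 divfK ?prod_but1_neq0.
    by rewrite (negPf ji) mul0r mulr0.
  apply: leq_trans (size_polyD _ _) _; rewrite geq_max sP size_polyN.
  apply: leq_trans (size_sum _ _ _) _; apply/bigmax_leqP => i _.
  by apply: leq_trans (size_scale_leq _ _) _; rewrite size_prod_but1.
rewrite [in RHS]PE coef_sum; apply: eq_bigr => i _.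
rewrite coefZ -(size_prod_but1 i) -lead_coefE.
by rewrite (eqP (monic_prod_XsubC _ _ _)) mulr1.
Qed.

End Interpolation.

Section Weights.
Variables (K : fieldType) (q Q : K) (M : nat).
Local Notation w := (q - q^-1).

(* [nodes x] packages the properties of [x r = q^(2 (la_r - r))] for a
   partition [la] with at most [M] rows. *)
Definition nodes (x : 'I_M.+1 -> K) : Prop :=
  [/\ injective x, forall i, x i != 0 & x ord_max = q ^- (2 * M)].

(** For a diagram, [x j] is the content of the cell just after row [j], and [x j / q ^+ 2] that of
    the last cell of row [j] if the row is nonempty. For equal consecutive rows [x j / q ^+ 2] is
    the next node, so at an addable row [r] the factors that survive cancellation come from
    removable and addable cells. *)
Definition branching (x : 'I_M.+1 -> K) r : K :=
  \prod_(j | j != ord_max) (x r - x j / q ^+ 2) / \prod_(j | j != r) (x r - x j).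

(* The coefficient of [1 / (1 - u * x r)] in the moment generating function in
   [u]; it vanishes when row [r] is not addable, as a factor of [branching] does. *)
Definition weight (x : 'I_M.+1 -> K) r : K :=
  (Q + (x r - 1) / w) / x r * branching x r.

Hypotheses (q0 : q != 0) (w0 : w != 0).

(** [weight x r] is the residue at [x r] of this polynomial divided by ['X] times the product of all
    ['X - x j]; see [weight_numE]. *)
Definition weight_num (x : 'I_M.+1 -> K) : {poly K} :=
  (w^-1 *: 'X + (Q - w^-1)%:P) * \prod_(j | j != ord_max) ('X - (x j / q ^+ 2)%:P).

Lemma weight_numE x r : x r != 0 ->
  weight x r = (weight_num x).[x r] / (x r * \prod_(j | j != r) (x r - x j)).
Proof.
move=> xr0; rewrite /weight /branching /weight_num hornerM horner_prod.
under [in RHS]eq_bigr do rewrite hornerXsubC.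
rewrite hornerD hornerZ hornerX hornerC [(x r * _)^-1]invfM.
move: (\prod_(j | j != r) _)^-1 (\prod_(j | _) _) (q - q^-1) w0 => B A v v0.
by field; apply/andP.
Qed.

Lemma size_weight_lin : size (w^-1 *: 'X + (Q - w^-1)%:P : {poly K}) = 2%N.
Proof.
rewrite size_polyDl size_scale ?invr_eq0 // size_polyX //. 
exact: leq_ltn_trans (size_polyC_leq1 _) _.
Qed.

Lemma size_prod_ord_max (x : 'I_M.+1 -> K) :
  size (\prod_(j | j != ord_max) ('X - (x j / q ^+ 2)%:P)) = M.+1.
Proof. by rewrite (size_prod_but1 (fun j => x j / q ^+ 2)) card_ord. Qed.

Lemma size_weight_num x : size (weight_num x) = M.+2.
Proof.
rewrite size_Mmonic ?monic_prod_XsubC ?size_weight_lin ?size_prod_ord_max //.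
by rewrite -size_poly_eq0 size_weight_lin.
Qed.

Lemma lead_coef_weight_num x : lead_coef (weight_num x) = w^-1.
Proof.
rewrite lead_coefM (eqP (monic_prod_XsubC _ _ _)) mulr1 lead_coefE size_weight_lin.
by rewrite coefD coefZ coefX coefC /= mulr1 addr0.
Qed.

(** The residues at the nodes and at the extra pole [0] add up to the leading coefficient [w^-1] of
    [weight_num x], and the residue at [0] is [w^-1 - Q]. *)
Lemma sum_weight x : nodes x -> \sum_r weight x r = Q.
Proof.
move=> [x_inj x0 xM].
(* [None] carries the extra node [0], which supplies the factor [x r] in the denominator of
   [weight_numE]. *)
pose x' o := if o is Some r then x r else 0.
have x'_inj : injective x'.
  move=> [i|] [j|] //= => [/x_inj-> //|xi|xj].
    by have := x0 i; rewrite xi eqxx.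
  by have := x0 j; rewrite -xj eqxx.
have := sum_interpolation x'_inj (P := weight_num x).
rewrite card_option card_ord size_weight_num leqnn => /(_ isT).
rewrite (bigD1 None) //= -[RHS]/((weight_num x)`_(M.+2).-1).
rewrite -(size_weight_num x) -lead_coefE lead_coef_weight_num.
rewrite !big_neq_None /=.
under [X in _ + X = _]eq_bigr => r _ do rewrite big_neq_Some /= subr0 -weight_numE //.
suff -> : (weight_num x).[0] / \prod_i (0 - x i) = w^-1 - Q.
  by move/(canRL (addKr _)) ->; rewrite opprB subrK.
rewrite hornerM horner_prod hornerD hornerZ hornerX hornerC mulr0 add0r.
(* The power of [q] collected from the [M] factors equals [x ord_max], so it cancels the last node
   in the denominator. *)
have -> : \prod_(j < M.+1 | j != ord_max) ('X - (x j / q ^+ 2)%:P).[0]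
    = \prod_(j < M.+1 | j != ord_max) (0 - x j) * q ^- (2 * M).
  under eq_bigr do rewrite hornerXsubC.
  have -> : q ^- (2 * M) = \prod_(j < M.+1 | j != ord_max) (q ^+ 2)^-1.
    by rewrite (prodr_const (predC1 ord_max)) cardC1 card_ord exprVn exprM.
  rewrite -big_split /=.
  by apply: eq_bigr => j _; rewrite mulrBl mul0r.
have P0 : \prod_(j < M.+1 | j != ord_max) (0 - x j) != 0.
  by apply/prodf_neq0 => j _; rewrite sub0r oppr_eq0.
rewrite [in X in _ / X](bigD1 ord_max) //= xM.
have q20 : q ^+ (2 * M) != 0 by rewrite expf_neq0.
move: (\prod_(j | _) _) (q ^+ (2 * M)) (q - q^-1) P0 q20 w0 => A B v A0 B0 v0.
by rewrite sub0r; field; rewrite A0 B0 v0 oppr_eq0 oner_eq0.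
Qed.

Section AddCell.
Variables (x x' : 'I_M.+1 -> K) (r0 : 'I_M.+1).
Hypotheses (xP : nodes x) (x'P : nodes x') (r0M : r0 != ord_max).
Hypothesis x'E : forall r, x' r = if r == r0 then q ^+ 2 * x r0 else x r.
Local Notation s := (x r0).

Let s0 : s != 0. Proof. by case: xP. Qed.

Let q2_neq1 : q ^+ 2 - 1 != 0.
Proof.
apply: contra w0 => /eqP q21; apply/eqP.
by apply: (mulfI q0); rewrite mulr0 mulrBr divff // -expr2.
Qed.

Let x's r : x' r - s != 0.
Proof.
rewrite x'E; case: (eqVneq r r0) => [_|rr0].
  by rewrite -[X in _ - X]mul1r -mulrBl mulf_neq0.
by rewrite subr_eq0; apply: contra rr0 => /eqP/(let: And3 x_inj _ _ := xP in x_inj) ->.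
Qed.

(** Chosen so that [1 - wcoef r] factors as [(x' r - q^2 s) (x' r - q^-2 s) / (x' r - s)^2]. *)
Definition wcoef r := w ^+ 2 * x' r * s / (x' r - s) ^+ 2.

(** From [x] to [x'] only the factors of row [r0] change: [x r - s / q ^+ 2] becomes [x r - s] in
    the numerator, and [x r - s] becomes [x r - q ^+ 2 * s] in the denominator. *)
Lemma weight_step r : r != r0 -> weight x r = weight x' r * (1 - wcoef r).
Proof.
move=> rr0; have xr : x' r = x r by rewrite x'E (negPf rr0).
have xs : x r - s != 0 by rewrite -xr x's.
have [x'_inj x'0 _] := x'P; have [x_inj x0 _] := xP.
have xs' : x r - q ^+ 2 * s != 0.
  have := x'E r0; rewrite eqxx => <-; rewrite -xr subr_eq0.
  by apply: contra rr0 => /eqP/x'_inj ->.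
rewrite /weight /branching /wcoef xr.
rewrite (bigD1 r0) //= [in RHS](bigD1 r0) //=.
rewrite [\prod_(j | j != r) (x r - x j)](bigD1 r0) 1?eq_sym //=.
rewrite [\prod_(j | j != r) (x r - x' j)](bigD1 r0) 1?eq_sym //=.
rewrite (x'E r0) eqxx.
have -> : \prod_(j | (j != ord_max) && (j != r0)) (x r - x' j / q ^+ 2)
   = \prod_(j | (j != ord_max) && (j != r0)) (x r - x j / q ^+ 2).
  by apply: eq_bigr => j /andP[_ jr0]; rewrite x'E (negPf jr0).
have -> : \prod_(j | (j != r) && (j != r0)) (x r - x' j)
   = \prod_(j | (j != r) && (j != r0)) (x r - x j).
  by apply: eq_bigr => j /andP[_ jr0]; rewrite x'E (negPf jr0).
have B0 : \prod_(j | (j != r) && (j != r0)) (x r - x j) != 0.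
  apply/prodf_neq0 => j /andP[jr _]; rewrite subr_eq0.
  by apply: contra jr => /eqP/x_inj ->.
move: (\prod_(j | _) _) B0 (\prod_(j | _) _) => B B0 A.
have := x0 r; move: (x r) (x r0) xs xs' => a b ab ab' a0.
by field; rewrite ?q0 ?w0 ?ab ?ab' ?a0 ?B0.
Qed.

Lemma wcoef_diag : 1 - wcoef r0 = 0.
Proof.
have := x's r0; have := w0; rewrite /wcoef x'E eqxx; move: (x r0) s0 => a a0 w1 aa.
by field; rewrite q0 aa.
Qed.

(** Both families of weights sum to [Q]; subtracting the values from [weight_step] isolates
    [weight x r0]. The term [r0] on the right fits because [wcoef r0] is [1]. *)
Lemma weight_diag : weight x r0 = \sum_r weight x' r * wcoef r.
Proof.
have := sum_weight xP; rewrite -(sum_weight x'P) (bigD1 r0) //= => /(canRL (addrK _)) ->.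
rewrite [in X in X - _](bigD1 r0) //= [RHS](bigD1 r0) //= -addrA -sumrB.
have /eqP := wcoef_diag; rewrite subr_eq0 => /eqP <-; rewrite mulr1; congr (_ + _).
apply: eq_bigr => r rr0; rewrite (weight_step rr0); ring.
Qed.

(** [s] is a root of [weight_num x'], because [x' r0 / q ^+ 2] is [s]. The quotient [P] has degree
    [M] and leading coefficient [w^-1], so interpolation at the [M.+1] nodes, without [0], gives the
    sum. *)
Lemma weight_pole : \sum_r weight x' r * x' r / (x' r - s) = w^-1.
Proof.
have [x'_inj x'0 _] := x'P.
pose P := (w^-1 *: 'X + (Q - w^-1)%:P)
   * \prod_(j | (j != ord_max) && (j != r0)) ('X - (x' j / q ^+ 2)%:P).
have numE : weight_num x' = ('X - s%:P) * P.
  rewrite /weight_num (bigD1 r0) //= x'E eqxx mulrCA; congr (_ * _).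
  by rewrite mulrC mulKf // expf_neq0.
have sP : size P = M.+1.
  have := size_weight_num x'; rewrite numE size_monicM ?monicXsubC //.
    by rewrite size_XsubC => -[].
  apply/eqP => P0; have := size_weight_num x'.
  by rewrite numE P0 mulr0 size_poly0.
have sP' : (size P <= #|'I_M.+1|)%N by rewrite sP card_ord.
have Pl : P`_(#|'I_M.+1|.-1) = w^-1.
  rewrite card_ord /= -[M in P`_M]/(M.+1.-1) -sP -lead_coefE.
  by rewrite -[lead_coef P]mul1r -(lead_coefXsubC s) -lead_coefM -numE lead_coef_weight_num.
rewrite -Pl -(sum_interpolation x'_inj sP').
apply: eq_bigr => r _; rewrite weight_numE // numE hornerM hornerXsubC.
have := x's r; have := x'0 r.
move: (\prod_(j | j != r) _) (prod_but1_neq0 x'_inj r) => B B0.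
by move: (x' r) => a a0 as0; field; rewrite B0 as0.
Qed.

(** The recursions for [ga] and [de] are those of [jm_traux] and [jm_trT], with the Jucys-Murphy
    element replaced by the content [s] of the added cell; [jm_Tr_step] takes them in this form. *)
Lemma weight_recursion :
  exists ga de : nat -> K,
  [/\ forall k, \sum_r weight x' r * x' r ^+ k = \sum_r weight x r * x r ^+ k + w * ga k,
      ga 0%N = 0, forall k, ga k.+1 = s * ga k + de k * s, de 0%N = 1
    & forall k, de k.+1 = de k * s + w * \sum_r weight x' r * x' r ^+ k.+1].
Proof.
(* [w * ga k] is the sum of [weight x' r * wcoef r * (x' r ^+ k - s ^+ k)], the change of the
   moments; [de k] is [w] times the sum in [weight_pole] with [x' r ^+ k] inserted. *)
exists (fun k => w * \sum_r weight x' r * x' r * s / (x' r - s) ^+ 2 * (x' r ^+ k - s ^+ k)).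
exists (fun k => w * \sum_r weight x' r * x' r / (x' r - s) * x' r ^+ k).
split.
- move=> k; rewrite (bigD1 r0 (F := fun r => weight x r * _)) //= weight_diag.
  have -> : \sum_(r | r != r0) weight x r * x r ^+ k
      = \sum_r weight x' r * (1 - wcoef r) * x' r ^+ k.
    rewrite [RHS](bigD1 r0) //= wcoef_diag mulr0 mul0r add0r.
    by apply: eq_bigr => r rr0; rewrite (weight_step rr0) x'E (negPf rr0).
  rewrite mulrA mulr_suml mulr_sumr -!big_split /=; apply: eq_bigr => r _.
  by rewrite /wcoef; ring.
- by rewrite big1 ?mulr0 // => r _; rewrite subrr mulr0.
- move=> k; rewrite mulrCA -mulrA -mulrDr; congr (_ * _).
  rewrite mulr_sumr mulr_suml -big_split /=; apply: eq_bigr => r _.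
  rewrite !exprS; have := x's r => a0; field; exact: a0.
- by under eq_bigr do rewrite mulr1; rewrite weight_pole divff.
- move=> k; rewrite -mulrA -mulrDr; congr (_ * _).
  rewrite mulr_suml -big_split /=; apply: eq_bigr => r _.
  rewrite !exprS; have := x's r => a0; field; exact: a0.
Qed.

End AddCell.

End Weights.

(** * Moments of the Jucys-Murphy elements *)

Section HeckeTower.
Variables (K : fieldType) (q : K).
Local Notation w := (q - q^-1).

Lemma hecke_inclE m (i : 'I_m.-1) :
  hecke_incl (hecke_gen q i) = hecke_incl_gen q i.
Proof. exact: hecke_hom_gen. Qed.

Lemma hecke_incl_comm n m (f : {lrmorphism hecke q m -> hecke q n}) (z : hecke q n) :
  (forall i, GRing.comm z (f (hecke_gen q i))) -> forall x, GRing.comm z (f x).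
Proof.
move=> zg x; rewrite -[x]hecke_reprK.
elim: (hecke_repr x) => {x} [i|a|x IHx y IHy|x IHx y IHy].
- exact: zg.
- have -> : hecke_class q (HScal a) = a%:A :> hecke q m.
    exact: esym (hecke_mulr1 _).
  by rewrite linearZ rmorph1 /GRing.comm -scalerAl -scalerAr mul1r mulr1.
- by rewrite -hecke_class_add [f _]rmorphD; apply: commrD.
- by rewrite -hecke_class_mul [f _]rmorphM; apply: commrM.
Qed.

Lemma hecke_T_comm m (x : hecke q m) :
  GRing.comm (hecke_T q m) (hecke_incl (hecke_incl x)).
Proof.
apply: (hecke_incl_comm (f := @hecke_incl K q m.+1 \o @hecke_incl K q m)) => i /=.
rewrite hecke_inclE hecke_inclE.
have [_ far _] := hecke_genP q m.+2.
by apply: far; have := ltn_ord i; rewrite /=; lia.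
Qed.

Lemma hecke_braid m :
  hecke_incl (hecke_T q m) * hecke_T q m.+1 * hecke_incl (hecke_T q m) =
  hecke_T q m.+1 * hecke_incl (hecke_T q m) * hecke_T q m.+1.
Proof.
rewrite hecke_inclE; have [braid _ _] := hecke_genP q m.+3.
exact: braid.
Qed.

(** Generators suffice. All but the last commute with the outer [T] and, by induction, with the
    inner Jucys-Murphy element; the last one passes by two braid moves. *)
Lemma jucys_murphy_comm m (x : hecke q m) :
  GRing.comm (jucys_murphy q m) (hecke_incl x).
Proof.
elim: m x => [|m IHm] x; first exact/commr_sym/commr1.
apply: hecke_incl_comm => /= i.
case: m i {x} IHm => [[]//|m] i IHm.
have [lti|gei] := ltnP i m.
  have -> : hecke_gen q (i : 'I_m.+2.-1) = hecke_incl (hecke_gen q (Ordinal lti : 'I_m.+1.-1)).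
    by rewrite hecke_inclE; congr (hecke_gen q _); apply: val_inj.
  have cT := hecke_T_comm (hecke_gen q (Ordinal lti : 'I_m.+1.-1)).
  apply/commr_sym; apply: commrM; last exact/commr_sym.
  apply: commrM; first exact/commr_sym.
  by rewrite /GRing.comm -!rmorphM IHm.
have -> : hecke_gen q (i : 'I_m.+2.-1) = hecke_T q m.
  by congr (hecke_gen q _); apply: val_inj; have := ltn_ord i; rewrite /= in gei *; lia.
rewrite /GRing.comm /=.
set S := hecke_incl (hecke_T q m); set T := hecke_T q m.+1.
rewrite !rmorphM /= -/S.
set z := hecke_incl (hecke_incl _).
have Tz : T * z = z * T by apply: hecke_T_comm.
have b : S * T * S = T * S * T by apply: hecke_braid.
(* The element is [T S z S T]. Multiplied by [S] on the right, it ends in [S T S], which becomes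
   [T S T]; then [T] passes [z], and the second braid move brings [S] to the front. *)
transitivity (T * S * z * (S * T * S)); first by rewrite !mulrA.
rewrite b; transitivity (T * S * T * z * S * T); last by rewrite -b !mulrA.
by rewrite -!mulrA (mulrA T z) Tz !mulrA.
Qed.

Section MarkovStep.
Variables (Q : K) (Tr : forall m, {linear hecke q m.+1 -> hecke q m}).
Hypothesis TrP : ocneanu_markov Q Tr.

Lemma Tr_inclr m (Z : hecke q m.+1) (Y : hecke q m) :
  Tr m (Z * hecke_incl Y) = Tr m Z * Y.
Proof. by have := om_bimodule TrP 1 Y Z; rewrite rmorph1 !mul1r. Qed.

Lemma Tr_incll m (Z : hecke q m.+1) (X : hecke q m) :
  Tr m (hecke_incl X * Z) = X * Tr m Z.
Proof. by have := om_bimodule TrP X 1 Z; rewrite rmorph1 !mulr1. Qed.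

Variable m : nat.
Local Notation y := (jucys_murphy q m).
Local Notation y' := (jucys_murphy q m.+1).
Local Notation T := (hecke_T q m).
Local Notation TV := (hecke_Tinv q m).

Let Ty : T * hecke_incl y = y' * TV.
Proof. by rewrite /= -mulrA hecke_TV mulr1. Qed.

Let y'T : y' * T = T * hecke_incl y + w *: y'.
Proof. by rewrite Ty /hecke_Tinv mulrBr -scalerAr mulr1 subrK. Qed.

(* [jm_aux k] is [sum_(1 <= i <= k) y'^i y^(k-i) T^-1]. *)
Fixpoint jm_aux k : hecke q m.+2 :=
  if k is k'.+1 then hecke_incl y * jm_aux k' + y' ^+ k' * T * hecke_incl y
  else 0.

(** Push [T] through the powers of [y] one factor at a time by [T y = y' (T - w)]; the error terms
    accumulate in [jm_aux]. *)
Lemma hecke_T_exp k :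
  T * hecke_incl y ^+ k * TV = y' ^+ k - w *: jm_aux k.
Proof.
have yy' : hecke_incl y * y' = y' * hecke_incl y by apply/esym/jucys_murphy_comm.
have TyT : T * (hecke_incl y * T) = y' by rewrite /= mulrA.
have auxS j : jm_aux j.+1 * T = hecke_incl y * (jm_aux j * T) + y' ^+ j.+1.
  by rewrite /= mulrDl exprSr -!mulrA TyT.
(* [jm_aux j * T] is a polynomial in the commuting elements [y] and [y']. *)
have cT j : (jm_aux j * T) * hecke_incl y = hecke_incl y * (jm_aux j * T).
  elim: j => [|j IHj]; first by rewrite /= !mul0r mulr0.
  rewrite auxS mulrDl mulrDr -mulrA IHj; congr (_ + _).
  exact/esym/commrX.
have main j : T * hecke_incl y ^+ j = (y' ^+ j - w *: jm_aux j) * T.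
  elim: j => [|j IHj]; first by rewrite !expr0 /= scaler0 subr0 mulr1 mul1r.
  rewrite exprSr mulrA IHj mulrBl -scalerAl mulrBl -scalerAl cT.
  rewrite mulrBl -scalerAl auxS exprSr -[_ * y' * T]mulrA y'T mulrDr -scalerAr -exprSr.
  by rewrite scalerDr opprD addrACA subrr addr0 -mulrA.
by rewrite main -mulrA hecke_TV mulr1.
Qed.

(** The value of [Tr m.+1 (y' ^+ k * T)], computed from [y' T = T y + w y']; [jm_traux] below is the
    trace of [jm_aux]. *)
Fixpoint jm_trT k : hecke q m.+1 :=
  if k is k'.+1 then jm_trT k' * y + w *: Tr m.+1 (y' ^+ k) else 1.

Fixpoint jm_traux k : hecke q m.+1 :=
  if k is k'.+1 then y * jm_traux k' + jm_trT k' * y else 0.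

Lemma Tr_jm_T k : Tr m.+1 (y' ^+ k * T) = jm_trT k.
Proof.
elim: k => [|k IHk]; first by rewrite expr0 mul1r (om_T TrP).
rewrite exprSr -mulrA y'T mulrDr -scalerAr -exprSr linearD linearZ /=.
by rewrite mulrA Tr_inclr IHk.
Qed.

Lemma Tr_jm_aux k : Tr m.+1 (jm_aux k) = jm_traux k.
Proof.
elim: k => [|k IHk] /=; first by rewrite linear0.
by rewrite linearD Tr_incll IHk Tr_inclr Tr_jm_T.
Qed.

(** Trace [hecke_T_exp]: invariance under conjugation by [T] turns its left side into the moment one
    level lower. *)
Lemma Tr_jm_exp k :
  Tr m.+1 (y' ^+ k) = hecke_incl (Tr m (y ^+ k)) + w *: jm_traux k.
Proof.
rewrite -(om_conjT TrP) rmorphXn hecke_T_exp linearB linearZ /= Tr_jm_aux.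
by rewrite subrK.
Qed.

End MarkovStep.

End HeckeTower.

(** * Evaluating traces of polynomials in the Jucys-Murphy elements *)

Section JMPolynomials.
Variables (K : fieldType) (q : K) (s : nat -> K).
Local Notation w := (q - q^-1).

(* [jm m X c]: [X] is a polynomial in the Jucys-Murphy elements of [H_m], and
   [c] is the value of that polynomial at [s 0, ..., s m.-1]. *)
Inductive jm : forall m, hecke q m -> K -> Prop :=
| jm_scalar m a : @jm m a%:A a
| jm_add m (X Y : hecke q m) a b : jm X a -> jm Y b -> jm (X + Y) (a + b)
| jm_mul m (X Y : hecke q m) a b : jm X a -> jm Y b -> jm (X * Y) (a * b)
| jm_incl m (X : hecke q m) a : jm X a -> jm (hecke_incl X) a
| jm_last m : jm (jucys_murphy q m) (s m).

Lemma jm_scale m a (X : hecke q m) b : jm X b -> jm (a *: X) (a * b).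
Proof. by move=> Xb; rewrite -mulr_algl; apply/jm_mul/Xb/jm_scalar. Qed.

(** Normal form: a polynomial in the last Jucys-Murphy element with coefficients from the previous
    algebra, so that the bimodule property reduces [Tr m] to moments. *)
Inductive jm_nf m : hecke q m.+1 -> K -> Prop :=
| jm_nf_mono (X : hecke q m) a k : jm X a ->
    jm_nf (hecke_incl X * jucys_murphy q m ^+ k) (a * s m ^+ k)
| jm_nf_add (X Y : hecke q m.+1) a b :
    jm_nf X a -> jm_nf Y b -> jm_nf (X + Y) (a + b).

Lemma jm_nf_mul m (X Y : hecke q m.+1) a b :
  jm_nf X a -> jm_nf Y b -> jm_nf (X * Y) (a * b).
Proof.
elim=> {X a} [X a k Xa|X X' a a' _ IH _ IH' Yb]; last first.
  by rewrite !mulrDl; apply: jm_nf_add; [apply: IH|apply: IH'].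
elim=> {Y b} [Y b l Yb|Y Y' b b' _ IH _ IH']; last first.
  by rewrite !mulrDr; apply: jm_nf_add.
have -> : hecke_incl X * jucys_murphy q m ^+ k * (hecke_incl Y * jucys_murphy q m ^+ l)
    = hecke_incl (X * Y) * jucys_murphy q m ^+ (k + l).
  rewrite rmorphM /= exprD !mulrA; congr (_ * _); rewrite -!mulrA; congr (_ * _).
  exact/esym/commrX/esym/jucys_murphy_comm.
have -> : a * s m ^+ k * (b * s m ^+ l) = a * b * s m ^+ (k + l).
  by rewrite mulrACA -exprD.
exact/jm_nf_mono/jm_mul.
Qed.

Lemma jm_nfP m (X : hecke q m.+1) a : jm X a -> jm_nf X a.
Proof.
(* A predicate on all levels, trivial at level [0], lets the induction run over the indexed family
   [jm]. *)
pose P n : hecke q n -> K -> Prop :=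
  match n with 0 => fun _ _ => True | n'.+1 => @jm_nf n' end.
have: forall n (Y : hecke q n) b, jm Y b -> P n Y b; last by move/(_ _ _ _); apply.
move=> n Y b; elim=> {n Y b}.
- case=> [//|n] b /=; have := jm_nf_mono 0 (jm_scalar n b).
  by rewrite linearZ /= rmorph1 !expr0 !mulr1.
- by case=> [//|n] Y Z b c _ IHY _ IHZ; apply: jm_nf_add.
- by case=> [//|n] Y Z b c _ IHY _ IHZ; apply: jm_nf_mul.
- by move=> n Y b Yb _ /=; have := jm_nf_mono 0 Yb; rewrite !expr0 !mulr1.
- move=> n /=; have := jm_nf_mono 1 (jm_scalar n 1).
  by rewrite linearZ /= rmorph1 !expr1 !mul1r scale1r mul1r.
Qed.

Lemma jm0 (X : hecke q 0) a : jm X a -> X = a%:A.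
Proof.
pose P n : hecke q n -> K -> Prop :=
  match n with 0 => fun Y b => Y = b%:A | _ => fun _ _ => True end.
have: forall n (Y : hecke q n) b, jm Y b -> P n Y b; last by move/(_ _ _ _); apply.
move=> n Y b; elim=> {n Y b} //; first by case.
  by case=> [|//] Y Z b c _ /= -> _ ->; rewrite scalerDl.
by case=> [|//] Y Z b c _ /= -> _ ->; rewrite mulr_algl scalerA.
Qed.

Section Trace.
Variables (Q : K) (Tr : forall m, {linear hecke q m.+1 -> hecke q m}).
Hypothesis TrP : ocneanu_markov Q Tr.

(** [be] and [al] are the values of the moments before and after the step, [ga] and [de] those of
    [jm_traux] and [jm_trT]. *)
Lemma jm_Tr_step m (al be ga de : nat -> K) :
  (forall k, jm (Tr m (jucys_murphy q m ^+ k)) (be k)) ->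
  (forall k, al k = be k + w * ga k) ->
  ga 0%N = 0 -> (forall k, ga k.+1 = s m * ga k + de k * s m) ->
  de 0%N = 1 -> (forall k, de k.+1 = de k * s m + w * al k.+1) ->
  forall k, jm (Tr m.+1 (jucys_murphy q m.+1 ^+ k)) (al k).
Proof.
move=> beP alE ga0 gaS de0 deS.
suff main : forall k, [/\ jm (Tr m.+1 (jucys_murphy q m.+1 ^+ k)) (al k),
    jm (jm_trT Tr m k) (de k) & jm (jm_traux Tr m k) (ga k)].
  by move=> k; case: (main k).
have trS k : jm (jm_traux Tr m k) (ga k) ->
    jm (Tr m.+1 (jucys_murphy q m.+1 ^+ k)) (al k).
  move=> gk; rewrite (Tr_jm_exp TrP) alE.
  by apply: jm_add; [apply: jm_incl; apply: beP | apply: jm_scale].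
elim=> [|k [_ dk gk]].
  have g0 : jm (jm_traux Tr m 0) (ga 0%N).
    by rewrite ga0 /= -(scale0r 1); apply: jm_scalar.
  split=> //; first exact: trS.
  by rewrite de0 /= -[X in jm X _]scale1r; apply: jm_scalar.
(* The order matters: [ga k.+1] needs only level [k], [al k.+1] needs [ga k.+1], and [de k.+1] needs
   [al k.+1]. *)
have gS : jm (jm_traux Tr m k.+1) (ga k.+1).
  by rewrite gaS /=; apply: jm_add; apply: jm_mul => //; apply: jm_last.
split=> //; first exact: trS.
rewrite deS; apply: jm_add; first by apply: jm_mul => //; apply: jm_last.
by apply: jm_scale; apply: trS.
Qed.

Lemma jm_Tr0 k : jm (Tr 0 (jucys_murphy q 0 ^+ k)) Q.
Proof.
rewrite /= expr1n -(rmorph1 (@hecke_incl K q 0)) (om_incl TrP).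
exact: jm_scalar.
Qed.

Local Notation tau := (markov_trace Tr).

Lemma markov_traceD m (X Y : hecke q m) : tau (X + Y) = tau X + tau Y.
Proof.
elim: m X Y => [|m IHm] X Y /=; first by rewrite /hecke0_val linearD.
by rewrite linearD IHm.
Qed.

Lemma markov_traceZ m a (X : hecke q m) : tau (a *: X) = a * tau X.
Proof.
elim: m X => [|m IHm] X /=; first by rewrite /hecke0_val linearZ.
by rewrite linearZ IHm.
Qed.

Lemma jm_Tr_prod m M (wt x : 'I_M -> K) (l : seq K) :
  (forall k, jm (Tr m (jucys_murphy q m ^+ k)) (\sum_r wt r * x r ^+ k)) ->
  forall k, jm (Tr m (\prod_(c <- l) (jucys_murphy q m - c%:A) * jucys_murphy q m ^+ k))
               (\sum_r wt r * \prod_(c <- l) (x r - c) * x r ^+ k).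
Proof.
set y := jucys_murphy q m => trP; elim: l => [|c l IHl] k.
  by rewrite big_nil mul1r; under eq_bigr do rewrite big_nil mulr1; apply: trP.
have cy : GRing.comm y (\prod_(c <- l) (y - c%:A)).
  apply: (big_ind (GRing.comm y)); [exact: commr1 | exact: commrM|].
  move=> d _; apply: commrB; first exact: commr_refl.
  by rewrite /GRing.comm -scalerAl -scalerAr mul1r mulr1.
have -> : \prod_(c <- c :: l) (y - c%:A) * y ^+ k
    = \prod_(c <- l) (y - c%:A) * y ^+ k.+1 + (- c) *: (\prod_(c <- l) (y - c%:A) * y ^+ k).
  rewrite big_cons mulrBl cy mulrBl exprS mulrA.
  by rewrite mulr_algl -scalerAl scaleNr.
have -> : \sum_r wt r * \prod_(c <- c :: l) (x r - c) * x r ^+ k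
    = \sum_r wt r * \prod_(c <- l) (x r - c) * x r ^+ k.+1
      + (- c) * \sum_r wt r * \prod_(c <- l) (x r - c) * x r ^+ k.
  rewrite mulr_sumr -big_split /=; apply: eq_bigr => r _.
  by rewrite big_cons exprS; ring.
by rewrite linearD linearZ; apply: jm_add => //; apply: jm_scale.
Qed.

(** In normal form the coefficient of [X] moves past the product over [l] to join [E]. What remains
    under [Tr m] has a trace whose value is a weighted sum over [r], and the product over [l] kills
    every term but [r0]. *)
Lemma markov_trace_eval m (E : hecke q m) e M (wt x : 'I_M -> K) (l : seq K) r0 :
  (forall X c, jm X c -> tau (E * X) = c * e) ->
  (forall k, jm (Tr m (jucys_murphy q m ^+ k)) (\sum_r wt r * x r ^+ k)) ->
  (forall r, r != r0 -> wt r * \prod_(c <- l) (x r - c) = 0) ->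
  x r0 = s m ->
  forall X c, jm X c ->
    tau (hecke_incl E * \prod_(c <- l) (jucys_murphy q m - c%:A) * X)
    = c * (wt r0 * \prod_(c <- l) (x r0 - c) * e).
Proof.
move=> EP trP lP xr0 X c /jm_nfP; elim=> {X c} [X c k Xc|X Y c d _ IHX _ IHY]; last first.
  by rewrite mulrDr markov_traceD IHX IHY mulrDl.
set y := jucys_murphy q m; set L := \prod_(c <- l) _.
have -> : hecke_incl E * L * (hecke_incl X * y ^+ k) = hecke_incl (E * X) * (L * y ^+ k).
  rewrite rmorphM /= !mulrA; congr (_ * _); rewrite -!mulrA; congr (_ * _).
  apply/esym; apply: (big_ind (GRing.comm (hecke_incl X))); [exact: commr1 | exact: commrM|].
  move=> d _; apply: commrB; first exact/esym/jucys_murphy_comm.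
  by rewrite /GRing.comm -scalerAl -scalerAr mul1r mulr1.
rewrite /= (Tr_incll TrP) -mulrA.
rewrite (EP _ (c * (wt r0 * \prod_(c <- l) (x r0 - c) * s m ^+ k))); first by ring.
apply: jm_mul => //.
have -> : wt r0 * \prod_(c <- l) (x r0 - c) * s m ^+ k
    = \sum_r wt r * \prod_(c <- l) (x r - c) * x r ^+ k.
  rewrite (bigD1 r0) //= xr0 [X in _ + X]big1 ?addr0 // => r rr0.
  by rewrite lP ?mul0r.
exact: jm_Tr_prod.
Qed.

End Trace.

End JMPolynomials.
(** * The hook product *)

Section HookRow.
Variables (K : fieldType) (phi : nat -> K) (a : nat) (b : nat -> nat).
Hypotheses (ba : forall i, (b i <= a)%N) (b_mono : forall i j, (i <= j)%N -> (b j <= b i)%N).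

Definition leg k j : nat := \sum_(i < k) (j < b i)%N.

(* Adding one more (shorter) row below raises the first [b k] hooks of the row
   by one, so their product telescopes. *)
Lemma hook_row k :
  \prod_(j < a) phi (a - j + leg k j) * \prod_(i < k) phi (a - b i + i.+1)
  = \prod_(i < a + k) phi i.+1.
Proof.
elim: k => [|k IHk].
  rewrite big_ord0 mulr1 addn0 (reindex_inj rev_ord_inj) /=.
  apply: eq_bigr => j _; rewrite /leg big_ord0 addn0; congr phi.
  by have := ltn_ord j; lia.
rewrite addnS [RHS]big_ord_recr /= -IHk big_ord_recr /= mulrA mulrAC.
rewrite [RHS]mulrAC; congr (_ * _).
rewrite -(big_mkord xpredT (fun j => phi (a - j + leg k.+1 j)%N)).
rewrite -(big_mkord xpredT (fun j => phi (a - j + leg k j)%N)).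
rewrite !(big_cat_nat (leq0n (b k)) (ba k)) /=.
rewrite mulrAC [RHS]mulrAC; congr (_ * _); last first.
  rewrite big_nat [RHS]big_nat; apply: eq_bigr => j /andP[bj _].
  by rewrite /leg big_ord_recr /= ltnNge bj addn0.
have legE j m : (j < b k)%N -> (m <= k.+1)%N -> leg m j = m.
  move=> jb mk; rewrite /leg (eq_bigr (fun=> 1%N)) ?sum1_card ?card_ord // => i _.
  by rewrite (leq_trans jb) // b_mono // -ltnS (leq_trans (ltn_ord i)).
have -> : \prod_(0 <= j < b k) phi (a - j + leg k.+1 j)%N
   = \prod_(0 <= j < b k) phi (a + k.+1 - j)%N.
  rewrite big_nat [RHS]big_nat; apply: eq_bigr => j jb.
  by rewrite legE //; congr phi; have := ba k; move: jb; rewrite /=; lia.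
have -> : \prod_(0 <= j < b k) phi (a - j + leg k j)%N
   = \prod_(0 <= j < b k) phi (a + k.+1 - j.+1)%N.
  rewrite big_nat [RHS]big_nat; apply: eq_bigr => j jb.
  by rewrite legE //; congr phi; have := ba k; move: jb; rewrite /=; lia.
(* The new factor completes the range: both sides are the product of [phi (a + k.+1 - j)] over
   [0 <= j <= b k]. *)
have -> : (a - b k + k.+1 = a + k.+1 - b k)%N by have := ba k; lia.
by rewrite -(big_nat_recr _ _ (fun j => phi (a + k.+1 - j)%N)) // big_nat_recl // subn0 mulrC addnS.
Qed.

End HookRow.

Section BetaNumbers.
Variables (K : fieldType) (q : K) (M : nat).
Hypotheses (q0 : q != 0) (q_free : forall m : int, m != 0 -> q ^ m != 1).
Local Notation w := (q - q^-1).

Lemma q_sub_inv_neq0 : w != 0.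
Proof.
rewrite subr_eq0; apply: contra (q_free (m := 2) isT) => /eqP qV.
by rewrite -exprnP expr2 {1}qV mulVf.
Qed.

Lemma qint_neq0 m : m != 0 -> qint q m != 0.
Proof.
move=> m0; rewrite /qint mulf_neq0 ?invr_eq0 ?q_sub_inv_neq0 // subr_eq0.
apply: contra (q_free (m := m + m) _) => [/eqP qm|].
  by rewrite expfzDr // {1}qm -expfzDr // addNr expr0z.
by apply: contra m0 => /eqP mm; apply/eqP; lia.
Qed.

Lemma qintN m : qint q (- m) = - qint q m.
Proof. by rewrite /qint opprK -mulNr opprB. Qed.

Definition legs la r j := leg (fun i => nth 0 la (i + r.+1)%N) (M - r) j.

Lemma hook_length_legs la r j : is_partition la -> (size la <= M.+1)%N ->
  (j < nth 0%N la r)%N ->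
  hook_length la (r, j) = (nth 0%N la r - j + legs la r j)%N.
Proof.
move=> laP sM jr.
have rs : (r < size la)%N by rewrite ltnNge; apply: contraL jr => sr; rewrite nth_default.
have jh : (j < head 0%N la)%N.
  by rewrite -nth0; apply: leq_trans jr (part_nth_leq laP (leq0n r)).
have conjE : nth 0%N (conj_part la) j = (r.+1 + legs la r j)%N.
  rewrite (nth_map 0%N) ?size_iota // nth_iota // add0n.
  rewrite -sum1_count big_mkcond /= (big_nth 0%N).
  have -> : (\sum_(0 <= i < size la) (if (j < nth 0 la i)%N then 1 else 0)
      = \sum_(0 <= i < M.+1) (j < nth 0 la i)%N)%N.
    rewrite (big_cat_nat (leq0n _) sM) /= [X in (_ + X)%N]big_nat [X in (_ + X)%N]big1 ?addn0.
      by apply: eq_bigr => i _; case: ltnP.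
    by move=> i /andP[si _]; rewrite nth_default.
  rewrite (big_cat_nat (leq0n r.+1)) /= ?(leq_trans rs) //; congr (_ + _)%N.
    transitivity (\sum_(0 <= i < r.+1) 1)%N; last by rewrite sum_nat_const_nat muln1.
    rewrite big_nat [RHS]big_nat; apply: eq_bigr => i /andP[_ ir].
    by rewrite (leq_trans jr) // part_nth_leq.
  by rewrite -{1}[r.+1]add0n big_addn subSS big_mkord.
by rewrite /hook_length /= conjE; lia.
Qed.

(** The diagram is padded to [M.+1] rows. For a partition these numbers decrease strictly for
    [r <= M], so even empty rows get distinct nodes. *)
Definition beta (la : seq nat) (r : nat) : int := (nth 0 la r + (M - r))%N.

Definition row_factor (r a : nat) : K :=
  \prod_(j < a) q ^ (j%:Z - r%:Z) / \prod_(i < a + (M - r)) qint q i.+1.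

Lemma hook_row_product la r : is_partition la -> (size la <= M.+1)%N ->
  \prod_(j < nth 0 la r) (q ^ content (r, j : nat) / qint q (hook_length la (r, j : nat)))
  = row_factor r (nth 0 la r)
    * \prod_(r.+1 <= t < M.+1) qint q (beta la r - beta la t).
Proof.
move=> laP sM; rewrite big_split /= /row_factor -mulrA; congr (_ * _).
have := @hook_row K (fun n => qint q n) (nth 0 la r) (fun i => nth 0 la (i + r.+1)%N).
move/(_ _ _ (M - r)%N) <-; last 2 first.
- by move=> i; apply: part_nth_leq laP _; lia.
- by move=> i j ij; apply: part_nth_leq laP _; lia.
have -> : \prod_(r.+1 <= t < M.+1) qint q (beta la r - beta la t)
    = \prod_(i < M - r) qint q (nth 0 la r - nth 0 la (i + r.+1) + i.+1)%N.
  rewrite -{1}[r.+1]add0n big_addn subSS big_mkord; apply: eq_bigr => i _; congr qint.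
  have := part_nth_leq laP (_ : r <= i + r.+1)%N; have := ltn_ord i; rewrite /beta; lia.
have -> : \prod_(j < nth 0 la r) (qint q (hook_length la (r, j : nat)))^-1
    = (\prod_(j < nth 0 la r) qint q (nth 0 la r - j + legs la r j)%N)^-1.
  by rewrite prodfV; congr _^-1; apply: eq_bigr => j _; rewrite hook_length_legs.
rewrite invfM -mulrA mulVf ?mulr1 //.
by apply/prodf_neq0 => i _; apply: qint_neq0; rewrite -lt0n addnS.
Qed.

(** The q-analogue of Frobenius' formula: [row_factor] has the q-factorial of the beta number in its
    denominator. *)
Lemma qhook_productE la : is_partition la -> (size la <= M.+1)%N ->
  qhook_product q la = \prod_(r < M.+1) row_factor r (nth 0%N la r)
    * \prod_(r < M.+1) \prod_(t < M.+1 | (r < t)%N) qint q (beta la r - beta la t).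
Proof.
move=> laP sM; rewrite /qhook_product /diagram big_allpairs_dep /=.
rewrite -[in iota 0 (size la)](subn0 (size la)) -big_split /=.
transitivity (\prod_(0 <= r < M.+1) \prod_(j < nth 0 la r)
   (q ^ content (r, j : nat) / qint q (hook_length la (r, j : nat)))).
  rewrite (big_cat_nat (leq0n _) sM) /= [X in _ = _ * X]big_nat [X in _ = _ * X]big1 ?mulr1.
    apply: eq_bigr => r _; rewrite -[in iota 0 _](subn0 (nth 0%N la r)).
    exact: big_mkord.
  by move=> r /andP[sr _]; rewrite nth_default ?big_ord0.
rewrite big_mkord; apply: eq_bigr => r _; rewrite hook_row_product //; congr (_ * _).
exact: big_geq_mkord.
Qed.

Lemma q_exp_inj m n : q ^ m = q ^ n -> m = n.
Proof.
move=> qmn; apply/eqP; rewrite -subr_eq0; apply: contraT => /q_free.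
by rewrite expfzDr // qmn -expfzDr // subrr expr0z eqxx.
Qed.

Definition row_node (la : seq nat) (r : 'I_M.+1) : K := qcontent q (r : nat, nth 0%N la r).

Lemma row_nodeE la (r : 'I_M.+1) : row_node la r = q ^ (2 * (beta la r - M%:Z)).
Proof.
rewrite /row_node /qcontent /content /beta /=; congr (_ ^ _).
by have := ltn_ord r; lia.
Qed.

Lemma beta_inj la : is_partition la -> injective (fun r : 'I_M.+1 => beta la r).
Proof.
move=> laP i j; wlog ij : i j / (i <= j)%N => [th|].
  by case: (leqP i j) => [/th//|/ltnW ji /esym/(th _ _ ji)].
have := part_nth_leq laP ij; have := ltn_ord i; have := ltn_ord j.
by rewrite /beta => jM iM laij bE; apply: val_inj => /=; lia.
Qed.

Lemma row_nodeP la : is_partition la -> (size la <= M)%N -> nodes q (row_node la).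
Proof.
move=> laP sM; split=> [i j|i|]; rewrite !row_nodeE.
- by move=> /q_exp_inj ij; apply: (beta_inj laP); lia.
- by rewrite expfz_neq0.
- rewrite /beta nth_default // subnn addn0 exprnN; congr (_ ^ _); lia.
Qed.

Lemma row_node_incr la (r0 r : 'I_M.+1) :
  row_node (incr_nth la r0) r = if r == r0 then q ^+ 2 * row_node la r0 else row_node la r.
Proof.
rewrite /row_node nth_incr_nth -[(r0 : nat) == r]/(r0 == r) eq_sym.
case: eqVneq => [->|_] //; rewrite /qcontent /content /= exprnP -expfzDr //.
by congr (_ ^ _); lia.
Qed.

Lemma row_factorS r a :
  row_factor r a.+1 * qint q (a + (M - r)).+1 = row_factor r a * q ^ (a%:Z - r%:Z).
Proof.
have n0 : \prod_(i < a + (M - r)) qint q i.+1 != 0.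
  by apply/prodf_neq0 => i _; apply: qint_neq0.
have l0 : qint q (a + (M - r)).+1 != 0 by apply: qint_neq0.
rewrite /row_factor addSn !big_ord_recr /=.
move: (\prod_(i < a) _) n0 l0 => A n0 l0.
by field; rewrite n0 l0.
Qed.

(* The factors of [branching] are q-integers of differences of beta numbers up
   to powers of [q] which almost cancel. *)
Lemma branching_beta la (r0 : 'I_M.+1) : is_partition la -> (size la <= M)%N ->
  branching q (row_node la) r0 * \prod_(t < M.+1 | t != r0) qint q (beta la r0 - beta la t)
  = q ^ (beta la r0 - M%:Z) * \prod_(t < M.+1 | t != ord_max) qint q (beta la r0 + 1 - beta la t).
Proof.
move=> laP sM; set l := beta la; have w0 := q_sub_inv_neq0.
pose G t := q ^ (l r0 + l t - 2 * M%:Z).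
have diffE (m n : int) : q ^ (2 * m) - q ^ (2 * n) = q ^ (m + n) * w * qint q (m - n).
  rewrite /qint -mulrA [w * _]mulrC divfK // mulrBr -!expfzDr //.
  by congr (q ^ _ - q ^ _); lia.
have E1 : \prod_(j | j != ord_max) (row_node la r0 - row_node la j / q ^+ 2)
    = \prod_(j < M.+1 | j != ord_max) G j * (w / q) ^+ M
      * \prod_(t < M.+1 | t != ord_max) qint q (l r0 + 1 - l t).
  have -> : (w / q) ^+ M = \prod_(j < M.+1 | j != ord_max) (w / q).
    by rewrite (prodr_const (predC1 ord_max)) cardC1 card_ord.
  rewrite -!big_split /=.
  apply: eq_bigr => j _; rewrite !row_nodeE -/(l r0) -/(l j).
  have -> : q ^ (2 * (l j - M%:Z)) / q ^+ 2 = q ^ (2 * (l j - M%:Z - 1)).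
    by rewrite exprnN -expfzDr //; congr (_ ^ _); lia.
  rewrite diffE; congr (_ * qint q _); last by lia.
  rewrite mulrA [RHS]mulrAC; congr (_ * _); rewrite /G -exprN1 -expfzDr //; congr (_ ^ _); lia.
have E2 : \prod_(j | j != r0) (row_node la r0 - row_node la j)
    = \prod_(j < M.+1 | j != r0) G j * w ^+ M * \prod_(t < M.+1 | t != r0) qint q (l r0 - l t).
  have -> : w ^+ M = \prod_(j < M.+1 | j != r0) w.
    by rewrite (prodr_const (predC1 r0)) cardC1 card_ord.
  rewrite -!big_split /=.
  apply: eq_bigr => j _; rewrite !row_nodeE -/(l r0) -/(l j) diffE.
  by congr (q ^ _ * _ * qint q _); lia.
have G0 j : G j != 0 by rewrite expfz_neq0.
have A0 : \prod_(t < M.+1 | t != r0) qint q (l r0 - l t) != 0.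
  apply/prodf_neq0 => t tr0; apply: qint_neq0; rewrite subr_eq0.
  by apply: contra tr0 => /eqP/(beta_inj laP) ->.
have P0 : \prod_(j < M.+1 | j != r0) G j != 0 by apply/prodf_neq0.
have GE : \prod_(j < M.+1 | j != ord_max) G j = \prod_(j < M.+1 | j != r0) G j * (G r0 / G M).
  apply: (mulfI (G0 M)); have := bigD1 (P := xpredT) (ord_max : 'I_M.+1) isT (F := fun j : 'I_M.+1 => G j) => /= <-.
  by rewrite (bigD1 r0) //= mulrCA [G M * _]mulrC divfK // mulrC.
rewrite /branching E1 E2 GE.
have -> : G r0 / G M = q ^ (l r0 - M%:Z) * q ^+ M.
  rewrite /G -[in X in _ / X](opprK (_ - _)) -invr_expz invrK -expfzDr // exprnP -expfzDr //.
  have -> : l M = 0 by rewrite /l /beta nth_default // subnn.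
  by congr (_ ^ _); lia.
rewrite expr_div_n.
have qM : q ^+ M != 0 by rewrite expf_neq0.
have wM : w ^+ M != 0 by rewrite expf_neq0.
move: (\prod_(j < M.+1 | j != r0) G j) (\prod_(t | t != r0) _) P0 A0 => P A P0 A0.
move: (w ^+ M) (q ^+ M) wM qM => W qq W0 qq0.
by field; rewrite P0 A0 W0 qq0.
Qed.

(** Isolates the pairs containing [r0]. The sign depends only on [r0], so it is the same before and
    after a cell is added to that row. *)
Lemma prod_pairs n (g : 'I_n -> 'I_n -> K) (r0 : 'I_n) : (forall i j, g i j = - g j i) ->
  \prod_(r < n) \prod_(t < n | (r < t)%N) g r t
  = \prod_(r < n | (r != r0) && (r < r0)%N) (-1) * \prod_(t < n | t != r0) g r0 t
    * \prod_(r < n | r != r0) \prod_(t < n | (r < t)%N && (t != r0)) g r t.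
Proof.
move=> gN; rewrite (bigD1 r0) //=.
have -> : \prod_(r < n | r != r0) \prod_(t < n | (r < t)%N) g r t
    = \prod_(r < n | (r != r0) && (r < r0)%N) g r r0
      * \prod_(r < n | r != r0) \prod_(t < n | (r < t)%N && (t != r0)) g r t.
  rewrite [X in X * _]big_mkcondr -big_split /=; apply: eq_bigr => r _.
  case: ltnP => rr0; first by rewrite (bigD1 r0).
  by rewrite mul1r; apply: eq_bigl => t; case: eqVneq => [->|]; rewrite ?andbT // ltnNge rr0.
rewrite mulrA; congr (_ * _).
have -> : \prod_(r < n | (r != r0) && (r < r0)%N) g r r0
    = \prod_(r < n | (r != r0) && (r < r0)%N) (-1) * \prod_(r < n | (r != r0) && (r < r0)%N) g r0 r.
  by rewrite -big_split /=; apply: eq_bigr => r _; rewrite gN mulN1r.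
rewrite mulrCA; congr (_ * _); rewrite mulrC [RHS](bigID (fun t : 'I_n => (t < r0)%N)) /=.
congr (_ * _); apply: eq_bigl => t; rewrite -leqNgt.
by rewrite ltn_neqAle eq_sym.
Qed.

Lemma qhook_product_incr la (r0 : 'I_M.+1) :
  is_partition la -> is_partition (incr_nth la r0) -> (size la <= M)%N -> r0 != ord_max ->
  qhook_product q (incr_nth la r0) = qhook_product q la * branching q (row_node la) r0.
Proof.
move=> laP muP sM r0M; set mu := incr_nth la r0.
have r0lt : (r0 < M)%N by rewrite ltn_neqAle r0M -ltnS ltn_ord.
have sM' : (size mu <= M.+1)%N by rewrite size_incr_nth; case: ifP => _; lia.
rewrite !qhook_productE //; last exact: leqW.
have muE (t : nat) : nth 0%N mu t = ((r0 == t :> nat) + nth 0 la t)%N by apply: nth_incr_nth.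
have mur0 : nth 0%N mu r0 = (nth 0%N la r0).+1 by rewrite muE eqxx.
have mut (t : 'I_M.+1) : t != r0 -> nth 0%N mu t = nth 0%N la t.
  by move=> tr0; rewrite muE -[(r0 : nat) == t]/(r0 == t) eq_sym (negPf tr0).
have bmur0 : beta mu r0 = beta la r0 + 1 by rewrite /beta mur0 addSn -addn1 PoszD.
have bmut (t : 'I_M.+1) : t != r0 -> beta mu t = beta la t by rewrite /beta => /mut ->.
have qN (nu : seq nat) (i j : 'I_M.+1) :
    qint q (beta nu i - beta nu j) = - qint q (beta nu j - beta nu i).
  by rewrite -qintN opprB.
rewrite !(prod_pairs (g := fun i j : 'I_M.+1 => qint q (beta _ i - beta _ j)) r0) //.
have -> : \prod_(r < M.+1 | r != r0)
      \prod_(t < M.+1 | (r < t)%N && (t != r0)) qint q (beta mu r - beta mu t)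
   = \prod_(r < M.+1 | r != r0)
      \prod_(t < M.+1 | (r < t)%N && (t != r0)) qint q (beta la r - beta la t).
  apply: eq_bigr => r rr0; apply: eq_bigr => t /andP[_ tr0].
  by rewrite !bmut.
have -> : \prod_(t < M.+1 | t != r0) qint q (beta mu r0 - beta mu t)
   = \prod_(t < M.+1 | t != r0) qint q (beta la r0 + 1 - beta la t).
  by apply: eq_bigr => t tr0; rewrite bmur0 bmut.
rewrite (bigD1 r0) //= [X in _ = X * _ * _](bigD1 r0) //= mur0.
have -> : \prod_(r < M.+1 | r != r0) row_factor r (nth 0%N mu r)
   = \prod_(r < M.+1 | r != r0) row_factor r (nth 0%N la r).
  by apply: eq_bigr => r rr0; rewrite mut.
have := row_factorS r0 (nth 0%N la r0).
have -> : (nth 0 la r0 + (M - r0))%N.+1%:Z = beta la r0 + 1 by rewrite -addn1 PoszD.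
have -> : (nth 0%N la r0)%:Z - r0%:Z = beta la r0 - M%:Z.
  rewrite /beta; have := ltn_ord r0; lia.
have := branching_beta r0 laP sM.
(* The two index ranges differ in [ord_max], where [beta] is [0], and in [r0], where the factor is
   [qint q 1 = 1]. The extra q-integer is the one in [row_factorS]. *)
have A1 : \prod_(t < M.+1 | t != r0) qint q (beta la r0 + 1 - beta la t)
    = qint q (beta la r0 + 1)
      * \prod_(t < M.+1 | t != ord_max) qint q (beta la r0 + 1 - beta la t).
  rewrite (bigD1 ord_max) 1?eq_sym //= [in RHS](bigD1 r0) //=.
  rewrite [_ + 1 - beta la r0]addrAC subrr add0r.
  have -> : qint q 1 = 1 by rewrite /qint divff ?q_sub_inv_neq0.
  rewrite mul1r {2}/beta nth_default // subnn subr0; congr (_ * _).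
  by apply: eq_bigl => t; rewrite andbC.
rewrite A1.
have : qint q (beta la r0 + 1) != 0 by apply: qint_neq0; rewrite /beta; lia.
move: (row_factor r0 _) (row_factor r0 _) (qint q (beta la r0 + 1)) => f1 f0 l.
move: (branching _ _ _) (q ^ _) (\prod_(t < M.+1 | t != r0) _) => br qc A.
move: (\prod_(t < M.+1 | t != ord_max) _) => B l0 brE f1E.
set P := \prod_(r < M.+1 | _) row_factor _ _; set E := \prod_(r < M.+1 | _) -1.
set W := \prod_(r < M.+1 | _) _.
transitivity (f0 * l * B * (P * E * W)); first by ring.
by rewrite f1E -[f1 * qc * B]mulrA -brE; ring.
Qed.

End BetaNumbers.

(** * Induction along a standard tableau *)

Lemma jm_ext (K : fieldType) (q : K) (s s' : nat -> K) m (X : hecke q m) c :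
  (forall k, (k < m)%N -> s k = s' k) -> jm s X c -> jm s' X c.
Proof.
move=> ss' Xc; elim: Xc ss' => {m X c}.
- by move=> m a _; apply: jm_scalar.
- by move=> m X Y a b _ IHX _ IHY ss'; apply: jm_add; [apply: IHX|apply: IHY].
- by move=> m X Y a b _ IHX _ IHY ss'; apply: jm_mul; [apply: IHX|apply: IHY].
- by move=> m X a _ IHX ss'; apply/jm_incl/IHX => k km; apply/ss'/leqW.
- by move=> m ss'; rewrite ss' //; apply: jm_last.
Qed.

Section QuantumDimension.
Variables (K : fieldType) (q Q : K) (M : nat).
Variable Tr : forall m, {linear hecke q m.+1 -> hecke q m}.
Local Notation w := (q - q^-1).
Hypotheses (q0 : q != 0) (q_free : forall m : int, m != 0 -> q ^ m != 1).
Hypothesis Q_free : forall m : int, Q + (q ^ (2 * m) - 1) / w != 0.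
Hypothesis TrP : ocneanu_markov Q Tr.

Let w0 : w != 0. Proof. exact: q_sub_inv_neq0. Qed.

(** For equal consecutive rows the numerator factor of [r'] in [branching] is zero. *)
Lemma weight_row_node0 la (r r' : 'I_M.+1) : r = r'.+1 :> nat ->
  nth 0%N la r = nth 0%N la r' -> weight q Q (row_node q la) r = 0.
Proof.
move=> rr' la_rr'; rewrite /weight /branching (bigD1 r') /=; last first.
  by rewrite -val_eqE /=; have := ltn_ord r; rewrite rr' ltnS; apply: contraTN => /eqP ->; rewrite ltnn.
suff -> : row_node q la r' / q ^+ 2 = row_node q la r by rewrite subrr !(mul0r, mulr0).
rewrite /row_node /qcontent exprnN -expfzDr // /content /= la_rr'; congr (_ ^ _).
by rewrite rr'; lia.
Qed.

Lemma weight_below la (r : 'I_M.+1) :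
  (size la < r)%N -> weight q Q (row_node q la) r = 0.
Proof.
move=> r_gt; have r'M : (r.-1 < M.+1)%N by apply: leq_ltn_trans (leq_pred r) (ltn_ord r).
apply: (weight_row_node0 (r' := Ordinal r'M)) => /=.
  by rewrite prednK // (leq_ltn_trans _ r_gt).
by rewrite !nth_default // ?(ltnW r_gt) // -ltnS prednK // (leq_ltn_trans _ r_gt).
Qed.

Lemma weight_not_addable la (r : 'I_M.+1) : is_partition la ->
  (r : nat, nth 0%N la r) \notin addable_cells la -> weight q Q (row_node q la) r = 0.
Proof.
move=> laP r_add.
have [r_le|r_gt] := leqP r (size la); last exact: weight_below.
case: (boolP (is_partition (incr_nth la r))) => [muP|].
  case/negP: r_add; apply/mapP; exists (r : nat) => //.
  by rewrite mem_filter muP mem_iota add0n ltnS r_le.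
case: (posnP r) => [r0|r_gt0] muP.
  by case/negP: muP; apply: is_partition_incr => // r'; rewrite r0.
have r'M : (r.-1 < M.+1)%N by apply: leq_ltn_trans (leq_pred r) (ltn_ord r).
apply: (weight_row_node0 (r' := Ordinal r'M)) => /=; first by rewrite prednK.
apply/eqP; rewrite eqn_leq part_nth_leq ?leq_pred //= leqNgt.
apply: contra muP => lt_r; apply: is_partition_incr => // r' rr'.
by move: lt_r; rewrite rr'.
Qed.

(** For the empty diagram only row [0] has nonzero weight; that weight is [Q] by [sum_weight], and
    the node is [1]. *)
Lemma jm_moment0 k s :
  jm s (Tr 0 (jucys_murphy q 0 ^+ k))
    (\sum_r weight q Q (row_node (M := M) q [::]) r * row_node q [::] r ^+ k).
Proof.
have /(sum_weight Q q0 w0) : nodes q (row_node (M := M) q [::]) by apply: row_nodeP.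
have wr (r : 'I_M.+1) : r != ord0 -> weight q Q (row_node (M := M) q [::]) r = 0.
  by rewrite -val_eqE -lt0n => r0; apply: weight_below.
have sumE (F : 'I_M.+1 -> K) : \sum_r weight q Q (row_node (M := M) q [::]) r * F r
    = weight q Q (row_node (M := M) q [::]) ord0 * F ord0.
  by rewrite (bigD1 ord0) //= big1 ?addr0 // => r r0; rewrite wr ?mul0r.
have := sumE (fun=> 1); under eq_bigr do rewrite mulr1; rewrite mulr1 => -> wQ.
have x0 : row_node q [::] (ord0 : 'I_M.+1) = 1.
  by rewrite /row_node /qcontent /content /= subrr mulr0 expr0z.
rewrite sumE wQ x0 [X in Q * X]expr1n mulr1.
exact: jm_Tr0.
Qed.

(** The claims are proved together: the moments of the next map [Tr n], evaluated at the contents of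
    [t], feed the evaluation claim one step later. The fixed bound [M] keeps the nodes of successive
    shapes on one index type. *)
Lemma markov_trace_standard n la t : (n <= M)%N ->
  is_partition la -> sumn la = n -> is_tableau la t -> is_standard t ->
  let s k := qcontent q (cell_of t k.+1) in
  [/\ forall k, jm s (Tr n (jucys_murphy q n ^+ k))
        (\sum_r weight q Q (row_node (M := M) q la) r * row_node q la r ^+ k),
      forall (X : hecke q n) c, jm s X c -> markov_trace Tr (Defs.idempotent q n t * X) = c * qdim Tr n t
    & qhook_product q la =
        qdim Tr n t * \prod_(1 <= k < n.+1)
          (qcontent q (cell_of t k)
           * (Q + (qcontent q (cell_of t k) - 1) / w)^-1)].
Proof.
elim: n la t => [|n IHn] la t nM laP lan tT tS s.
  have la0 : la = [::].
    case: la laP lan {tT} => // a la /andP[_]; rewrite inE negb_or eq_sym -lt0n /=.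
    by case: a.
  rewrite la0 /= /qdim /=; split=> [k|X c Xc|].
  - exact: jm_moment0.
  - have -> : hecke0_val (1 : hecke q 0) = 1 by rewrite /hecke0_val rmorph1.
    rewrite mul1r (jm0 Xc) /hecke0_val linearZ rmorph1 /=.
    by rewrite /GRing.scale /= mulr1.
  - rewrite big_nil /hecke0_val rmorph1 mulr1 /qhook_product /= big_nil //.
have [muP mun uT uS [laE c2E c1_le c_u]] := standard_remove laP lan tT tS.
set u := remove_entry n.+1 t in muP mun uT uS laE c2E c1_le c_u.
set mu := shape u in muP mun uT laE c2E c1_le.
case alE: (cell_of t n.+1) laE c2E c1_le => [a b] /= laE bE a_le; rewrite bE in alE => {b bE}.
have [] := IHn _ _ (ltnW nM) muP mun uT uS.
set su := fun k => _ => A_u B_u C_u.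
have su_s k : (k < n)%N -> su k = s k.
  by move=> kn; rewrite /su /s c_u.
have size_mu : (size mu <= n)%N.
  case/andP: muP => _; rewrite -mun; elim: (mu) => //= d v IHv.
  rewrite inE negb_or eq_sym -lt0n => /andP[d0 /IHv]; lia.
have a_n : (a <= n)%N := leq_trans a_le size_mu.
have r0M : (a < M.+1)%N by rewrite ltnS (leq_trans a_n) // ltnW.
pose r0 : 'I_M.+1 := Ordinal r0M.
have r0_max : r0 != ord_max by rewrite -val_eqE /= neq_ltn (leq_ltn_trans a_n).
have size_mu_M : (size mu <= M)%N by rewrite (leq_trans size_mu) // ltnW.
have s_n : s n = row_node q mu r0.
  by rewrite /s alE.
have xP : nodes q (row_node (M := M) q mu) by apply: row_nodeP.
have x'P : nodes q (row_node (M := M) q la).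
  apply: row_nodeP => //; rewrite laE size_incr_nth; case: ifP => _ //.
  exact: leq_ltn_trans a_n nM.
have x'E (r : 'I_M.+1) : row_node q la r
    = if r == r0 then q ^+ 2 * row_node q mu r0 else row_node q mu r.
  by rewrite laE -[a]/(r0 : nat) row_node_incr.
pose others := [seq c <- addable_cells mu | c != (a, nth 0%N mu a)].
pose L := [seq qcontent q c | c <- others].
have node_in c : c \in addable_cells mu ->
    exists2 r : 'I_M.+1, qcontent q c = row_node q mu r & c = (r : nat, nth 0%N mu r).
  case/mapP => i; rewrite mem_filter mem_iota add0n => /andP[_ ilt] cE.
  have iM : (i < M.+1)%N by apply: leq_trans ilt _.
  by exists (Ordinal iM); rewrite cE.
have ka0 : \prod_(c <- L) (row_node q mu r0 - c) != 0.
  rewrite prodf_seq_neq0; apply/allP => _ /mapP[c + ->] /=.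
  rewrite mem_filter => /andP[c_al /node_in[r -> cE]].
  rewrite subr_eq0; apply: contra c_al => /eqP.
  case: xP => x_inj _ _ /x_inj rr0; by rewrite cE -rr0.
(* A row that is not addable has weight zero; an addable row other than [r0] has its node among the
   roots [L]. *)
have wL r : r != r0 -> weight q Q (row_node q mu) r * \prod_(c <- L) (row_node q mu r - c) = 0.
  move=> rr0; have [r_add|/(weight_not_addable muP) ->] :=
    boolP ((r : nat, nth 0%N mu r) \in addable_cells mu); last by rewrite mul0r.
  apply/eqP; rewrite mulf_eq0; apply/orP; right; rewrite prodf_seq_eq0.
  apply/hasP; exists (row_node q mu r); last by rewrite subrr eqxx.
  apply/mapP; exists (r : nat, nth 0%N mu r) => //; rewrite mem_filter r_add andbT.
  by apply: contra rr0 => /eqP [ra _]; apply/eqP/val_inj.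
have idE : Defs.idempotent q n.+1 t = (\prod_(c <- L) (row_node q mu r0 - c))^-1
    *: (hecke_incl (Defs.idempotent q n u) * \prod_(c <- L) (jucys_murphy q n - c%:A)).
  by rewrite /= -/u -/mu alE -/others /L !big_map.
have A_u' k : jm s (Tr n (jucys_murphy q n ^+ k))
    (\sum_r weight q Q (row_node (M := M) q mu) r * row_node q mu r ^+ k).
  by apply: jm_ext su_s _; apply: A_u.
(* The product over [L] at the node of [r0] cancels against the normalising factor of the
   idempotent. *)
have B_t (X : hecke q n.+1) c : jm s X c -> markov_trace Tr (Defs.idempotent q n.+1 t * X)
    = c * (weight q Q (row_node q mu) r0 * qdim Tr n u).
  move=> Xc; rewrite idE -scalerAl markov_traceZ.
  rewrite (markov_trace_eval TrP (r0 := r0) _ A_u' wL (esym s_n) Xc (e := qdim Tr n u)).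
    by field.
  by move=> Y d Yd; apply: B_u; apply: jm_ext Yd => k kn; rewrite su_s.
have dimE : qdim Tr n.+1 t = weight q Q (row_node q mu) r0 * qdim Tr n u.
  by have := B_t _ _ (jm_scalar q s n.+1 1); rewrite scale1r mulr1 mul1r.
split.
- have [ga [de [alS ga0 gaS de0 deS]]] := weight_recursion Q q0 w0 xP x'P r0_max x'E.
  by apply: (jm_Tr_step TrP A_u' alS ga0 _ de0 _) => k; rewrite s_n.
- by move=> X c; rewrite dimE; apply: B_t.
have wt0 : row_node q mu r0 * (Q + (row_node q mu r0 - 1) / w)^-1
    * weight q Q (row_node q mu) r0 = branching q (row_node q mu) r0.
  have x0 : row_node q mu r0 != 0 by case: xP.
  have Q0 : Q + (row_node q mu r0 - 1) / w != 0 by apply: Q_free.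
  rewrite /weight; move: (Q + _) Q0 => v v0.
  by field; rewrite x0 v0.
rewrite laE -[a]/(r0 : nat) qhook_product_incr // -?laE // C_u dimE.
rewrite [in RHS]big_nat_recr // alE -[qcontent q (a, _)]/(row_node q mu r0) -wt0.
have -> : \prod_(1 <= k < n.+1) (qcontent q (cell_of u k)
      * (Q + (qcontent q (cell_of u k) - 1) / w)^-1)
   = \prod_(1 <= k < n.+1) (qcontent q (cell_of t k)
      * (Q + (qcontent q (cell_of t k) - 1) / w)^-1).
  by rewrite big_nat [RHS]big_nat; apply: eq_bigr => k; rewrite ltnS => /c_u ->.
move: (weight _ _ _ _) (qdim Tr n u) (\prod_(1 <= k < n.+1) _) (_ * _^-1) => b1 b2 b3 b4.
by rewrite /=; ring.
Qed.

End QuantumDimension.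

(** * Nonvanishing in the field of rational functions *)

Section RationalFunctions.
Variable R : realType.
Local Notation q := (qvar R).

Lemma qvar_neq0 : q != 0.
Proof. by rewrite /qvar tofrac_eq0 polyX_eq0. Qed.

Lemma qvar_free (m : int) : m != 0 -> q ^ m != 1.
Proof.
have free n : q ^+ n.+1 != 1.
  rewrite -tofracXn -tofrac1 tofrac_eq; apply/eqP => /(congr1 (fun p : {poly _} => size p)).
  by rewrite size_polyXn size_poly1.
case: m => [[|n]|n] // _; first exact: free.
by rewrite NegzE -exprnN invr_eq1 free.
Qed.

(* After clearing denominators the even and odd powers of [q] cannot cancel. *)
Lemma qvar_shift_neq0 (Q : R[i]) (m : int) : Q != 0 ->
  Cq_const Q + (q ^ (2 * m) - 1) / (q - q^-1) != 0.
Proof.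
move=> Q0; have q0 := qvar_neq0; have w0 := q_sub_inv_neq0 q0 qvar_free.
have [a [b ->]] : exists a b : nat, m = b%:Z - a%:Z.
  by case: m => n; [exists 0%N, n|exists n.+1, 0%N]; rewrite ?NegzE; lia.
(* [p] is the given element times [(q - q^-1) q^(2a+1)]; its coefficient of degree [2 * a] is
   [- Q]. *)
pose p : {poly R[i]} := Q%:P * ('X^((2 * a).+2) - 'X^(2 * a)) + ('X^((2 * b).+1) - 'X^((2 * a).+1)).
have p0 : p != 0.
  apply: contraNneq Q0 => /(congr1 (fun r : {poly _} => r`_(2 * a))).
  rewrite coefD coefCM !coefB !coefXn coef0 eqxx.
  have -> : (2 * a == (2 * a).+2)%N = false by lia.
  have -> : (2 * a == (2 * b).+1)%N = false by lia.
  have -> : (2 * a == (2 * a).+1)%N = false by lia.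
  by rewrite sub0r subrr addr0 mulrN1 => /eqP; rewrite oppr_eq0.
have pE : tofrac p = (Cq_const Q + (q ^ (2 * (b%:Z - a%:Z)) - 1) / (q - q^-1))
    * (q - q^-1) * q ^+ (2 * a).+1.
  rewrite mulrDl divfK // mulrDl [(_ - 1) * _]mulrBl.
  have -> : q ^ (2 * (b%:Z - a%:Z)) * q ^+ (2 * a).+1 = q ^+ (2 * b).+1.
    by rewrite !exprnP -expfzDr //; congr (_ ^ _); lia.
  rewrite /p tofracD tofracM !tofracB !tofracXn -/q -/(Cq_const Q) mul1r; congr (_ + _).
  rewrite -mulrA; congr (_ * _); rewrite mulrBl -exprS; congr (_ - _).
  by rewrite exprS mulKf.
by apply: contraNneq p0 => p1; rewrite -tofrac_eq0 pE p1 !mul0r.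
Qed.

End RationalFunctions.

Theorem proposition4p3 (R : realType) (n : nat) (la : seq nat)
    (t : seq (seq nat)) (Q : R[i])
    (Tr : forall m, {linear hecke (qvar R) m.+1 -> hecke (qvar R) m}) :
  is_partition la -> sumn la = n ->
  is_tableau la t -> is_standard t ->
  Q != 0 ->
  ocneanu_markov (Cq_const Q) Tr ->
  let q := qvar R in
  let sigma k := qcontent q (cell_of t k) in
  qhook_product q la =
    qdim Tr n t *
    \prod_(1 <= k < n.+1)
      (sigma k * (Cq_const Q + (sigma k - 1) / (q - q^-1))^-1).
Proof.
move=> laP lan tT tS Q0 TrP q sigma.
(* The row bound [M] is taken to be [n]. *)
have [_ _ fE] := markov_trace_standard (qvar_neq0 R) (@qvar_free R)
  (fun m => qvar_shift_neq0 m Q0) TrP (leqnn n) laP lan tT tS.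
exact: fE.
Qed.
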